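(* Fix $\ell>0$. For each $N\in\mathbb{N}_0=\{0,1,2,\dots\}$ there exist $\varepsilon_{0,N}>0$ and $C^\infty$ functions $$\varepsilon\longmapsto(a_N(\varepsilon),b_N(\varepsilon),\lambda_N(\varepsilon))\in\mathbb{R}^3,\qquad|\varepsilon|<\varepsilon_{0,N},$$ with $(a_N(0),b_N(0),\lambda_N(0))=((2N+1)\pi/\ell,0,0)$, such that for each $|\varepsilon|<\varepsilon_{0,N}$ the solution $(k,p,q,\theta)$ on $[0,\ell]$ of $$k_s=p,\quad p_s=q,\quad q_s=c\cos\theta,\quad\theta_s=k,\qquad k(0)=a,\ p(0)=0,\ q(0)=b,\ \theta(0)=\tfrac{\pi}{2},\qquad c:=ab+\lambda,$$ with $(a,b,\lambda)=(a_N(\varepsilon),b_N(\varepsilon),\lambda_N(\varepsilon))$ satisfies $$\theta(\ell)=\frac{\pi}{2}+(2N+1)\pi,\qquad p(\ell)=0,\qquad q(\ell)=\varepsilon.$$ Moreover: (i) $\lambda_N(\varepsilon)>0$ for all sufficiently small $\varepsilon\ne0$. (ii) For $0<|\varepsilon|<\varepsilon_{0,N}$ the corresponding arc extends by repeated reflection (as described in the context) to a $C^\infty$ unit-speed immersion $\Gamma_{N,\varepsilon}:\mathbb{R}\to\mathbb{R}^2$, stationary for $J_{\lambda_N(\varepsilon)}$, whose tangent is $2\ell$-periodic and whose position is periodic up to translation: $$\Gamma_{N,\varepsilon}(s+2\ell)=\Gamma_{N,\varepsilon}(s)+P_{N,\varepsilon},\qquad P_{N,\varepsilon}\ne0.$$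 In particular $\Gamma_{N,\varepsilon}$ is not closed. (iii) If $N\ne M$, then $\Gamma_{N,\varepsilon}$ and $\Gamma_{M,\varepsilon'}$ are not congruent for any sufficiently small $\varepsilon,\varepsilon'\ne0$. More precisely, their mean turning rates are $\Omega(\Gamma_{N,\varepsilon})=(2N+1)\pi/\ell$. (iv) For every prescribed $\lambda_\ast>0$, one can choose one sufficiently small nonzero parameter $\varepsilon_N$ on each $N$-branch and dilate the corresponding waves $\Gamma_{N,\varepsilon_N}$ to obtain infinitely many pairwise non-congruent circular waves stationary for $J_{\lambda_\ast}$. Consequently, there exist infinitely many geometrically distinct (pairwise non-congruent) circular waves.
   Context: For a planar curve with arclength $s$, signed curvature $k$ and length $L$, $J_\lambda:=\frac12\int k_s^2\,ds+\lambda L$. An immersion $\Gamma:\mathbb{R}\to\mathbb{R}^2$ (of infinite length) is stationary for $J_\lambda$ if the Euler–Lagrange equation $k_{ssss}+k^2k_{ss}-\frac12kk_s^2+\lambda k=0$ holds, equivalently the first variation of $J_\lambda$ vanishes for all compactly supported variations. Extension by repeated reflection: given $\theta$ on $[0,\ell]$ as in the theorem, set $\theta^{(2)}(s)=\theta(s)$ for $0\le s\le\ell$ and $\theta^{(2)}(s)=(\pi+2(2N+1)\pi)-\theta(2\ell-s)$ for $\ell\le s\le2\ell$; define $\Theta:\mathbb{R}\to\mathbb{R}$ by $\Theta(s+2m\ell)=\theta^{(2)}(s)+2m(2N+1)\pi$ for $s\in[0,2\ell]$, $m\in\mathbb{Z}$; and set $\Gamma_{N,\varepsilon}(s)=\int_0^s(\cos\Theta,\sin\Theta)\,d\sigma$.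 A circular wave is an immersion $\mathbb{R}\to\mathbb{R}^2$ arising as such a $\Gamma_{N,\varepsilon}$ with $\varepsilon\neq0$, or as a dilation of one. The unit-speed dilation of $\Gamma$ by $\rho>0$ is $s\mapsto\rho\,\Gamma(s/\rho)$. Mean turning rate: for a unit-speed immersion $\Gamma:\mathbb{R}\to\mathbb{R}^2$ with nonconstant periodic tangent and continuous lifted tangent angle $\Theta$ (so $\Gamma_s=(\cos\Theta,\sin\Theta)$), $\Omega(\Gamma):=\lim_{R\to\infty}|\Theta(R)-\Theta(0)|/R$. Two such curves are congruent if they agree up to a Euclidean isometry and a unit-speed reparametrisation $s\mapsto\pm s+s_0$. *)

(* Defs.v *)
From Stdlib Require Import Reals Lra ZArith.
From Coquelicot Require Import Coquelicot.
Open Scope R_scope.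

(* Derivative relative to a set D: one-sided at an endpoint of an interval. *)
Definition is_derive_within (D : R -> Prop) (f : R -> R) (x l : R) : Prop :=
  filterdiff f (within D (locally x)) (fun h : R => scal h l).

Definition smooth_on (D : R -> Prop) (f : R -> R) : Prop :=
  forall (n : nat) (x : R), D x -> ex_derive_n f n x.

Record arc_solution (l a b lam : R) (k p q th : R -> R) : Prop := {
  arc_k : forall s, 0 <= s <= l ->
    is_derive_within (fun t => 0 <= t <= l) k s (p s);
  arc_p : forall s, 0 <= s <= l ->
    is_derive_within (fun t => 0 <= t <= l) p s (q s);
  arc_q : forall s, 0 <= s <= l ->
    is_derive_within (fun t => 0 <= t <= l) q s ((a * b + lam) * cos (th s));
  arc_th : forall s, 0 <= s <= l ->
    is_derive_within (fun t => 0 <= t <= l) th s (k s);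
  arc_k0 : k 0 = a;
  arc_p0 : p 0 = 0;
  arc_q0 : q 0 = b;
  arc_th0 : th 0 = PI / 2
}.

Definition the_arc_solution (l a b lam : R) (k p q th : R -> R) : Prop :=
  arc_solution l a b lam k p q th /\
  forall k' p' q' th' : R -> R, arc_solution l a b lam k' p' q' th' ->
    forall s, 0 <= s <= l ->
      k' s = k s /\ p' s = p s /\ q' s = q s /\ th' s = th s.

Definition curve := R -> R * R.

Definition cx (g : curve) (t : R) : R := fst (g t).
Definition cy (g : curve) (t : R) : R := snd (g t).

Definition velocity (g : curve) (t : R) : R * R :=
  (Derive (cx g) t, Derive (cy g) t).

Definition speed (g : curve) (t : R) : R :=
  sqrt (Derive (cx g) t ^ 2 + Derive (cy g) t ^ 2).

Definition smooth_curve (g : curve) : Prop :=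
  smooth_on (fun _ => True) (cx g) /\ smooth_on (fun _ => True) (cy g).

Definition immersion (g : curve) : Prop :=
  smooth_curve g /\ forall t, 0 < speed g t.

Definition unit_speed_immersion (g : curve) : Prop :=
  immersion g /\ forall t, speed g t = 1.

Definition infinite_length (g : curve) : Prop :=
  is_lim (fun r => RInt (speed g) (- r) r) p_infty p_infty.

Definition arclength_derive (g : curve) (f : R -> R) (t : R) : R :=
  Derive f t / speed g t.

Definition curvature (g : curve) (t : R) : R :=
  (Derive (cx g) t * Derive_n (cy g) 2 t - Derive (cy g) t * Derive_n (cx g) 2 t)
  / speed g t ^ 3.

(* The Euler-Lagrange equation of J_lam = 1/2 int k_s^2 ds + lam L. *)
Definition stationary (lam : R) (g : curve) : Prop :=
  immersion g /\ infinite_length g /\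
  let k := curvature g in
  let k_s := arclength_derive g k in
  let k_ss := arclength_derive g k_s in
  let k_sss := arclength_derive g k_ss in
  let k_ssss := arclength_derive g k_sss in
  forall t, k_ssss t + k t ^ 2 * k_ss t - 1 / 2 * k t * k_s t ^ 2 + lam * k t = 0.

Definition closed_curve (g : curve) : Prop :=
  exists T, 0 < T /\ forall s, g (s + T) = g s.

Definition isometry (F : R * R -> R * R) : Prop :=
  forall u v : R * R,
    dist_euc (fst (F u)) (snd (F u)) (fst (F v)) (snd (F v)) =
    dist_euc (fst u) (snd u) (fst v) (snd v).

Definition congruent (g h : curve) : Prop :=
  exists (F : R * R -> R * R) (sigma s0 : R),
    isometry F /\ (sigma = 1 \/ sigma = -1) /\
    forall s, h s = F (g (sigma * s + s0)).

Definition tangent_angle (g : curve) (Th : R -> R) : Prop :=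
  (forall s, continuous Th s) /\
  forall s, velocity g s = (cos (Th s), sin (Th s)).

Definition nonconstant_periodic_tangent (g : curve) : Prop :=
  (exists T, 0 < T /\ forall s, velocity g (s + T) = velocity g s) /\
  exists s s', velocity g s <> velocity g s'.

(* Omega(g) = w. Two continuous lifts differ by a constant, so the limit does
   not depend on the lift. *)
Definition mean_turning_rate (g : curve) (w : R) : Prop :=
  unit_speed_immersion g /\ nonconstant_periodic_tangent g /\
  exists Th, tangent_angle g Th /\
    is_lim (fun r => Rabs (Th r - Th 0) / r) p_infty w.

Definition dilate (rho : R) (g : curve) : curve :=
  fun s => (rho * fst (g (s / rho)), rho * snd (g (s / rho))).

Definition half_turns (N : nat) : R := (2 * INR N + 1) * PI.

Definition reflect_angle (l : R) (N : nat) (th : R -> R) (s : R) : R :=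
  if Rle_dec s l then th s
  else (PI + 2 * half_turns N) - th (2 * l - s).

(* The index m of the period [2ml, 2(m+1)l) containing s is the floor of
   s / (2l); [extend_angle_shift] shows that the closed right endpoint is
   consistent with this choice. *)
Definition extend_angle (l : R) (N : nat) (th : R -> R) (s : R) : R :=
  let m := IZR (Int_part (s / (2 * l))) in
  reflect_angle l N th (s - 2 * m * l) + 2 * m * half_turns N.

Definition wave (l : R) (N : nat) (th : R -> R) : curve :=
  fun s => (RInt (fun t => cos (extend_angle l N th t)) 0 s,
            RInt (fun t => sin (extend_angle l N th t)) 0 s).

Lemma reflect_angle_right (l : R) (N : nat) (th : R -> R) (s : R) :
  th l = PI / 2 + half_turns N -> l <= s ->
  reflect_angle l N th s = (PI + 2 * half_turns N) - th (2 * l - s).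
Proof.
  intros Hl Hs; unfold reflect_angle; destruct (Rle_dec s l) as [H|H].
  - replace s with l by lra. replace (2 * l - l) with l by ring. lra.
  - reflexivity.
Qed.

Lemma extend_angle_shift (l : R) (N : nat) (th : R -> R) (s : R) (m : Z) :
  0 < l -> th 0 = PI / 2 -> 0 <= s <= 2 * l ->
  extend_angle l N th (s + 2 * IZR m * l) =
  reflect_angle l N th s + 2 * IZR m * half_turns N.
Proof.
  intros Hl H0 [Hs1 Hs2]; unfold extend_angle.
  assert (Hd : (s + 2 * IZR m * l) / (2 * l) = s / (2 * l) + IZR m)
    by (field; lra).
  destruct (Rle_lt_or_eq_dec _ _ Hs2) as [Hs | Hs].
  - assert (E : Int_part ((s + 2 * IZR m * l) / (2 * l)) = m).
    { symmetry; apply Int_part_spec; rewrite Hd.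
      assert (0 <= s / (2 * l)) by (apply Rdiv_le_0_compat; lra).
      assert (s / (2 * l) < 1) by (apply Rlt_div_l; lra).
      lra. }
    rewrite E. f_equal. f_equal. ring.
  - assert (E : Int_part ((s + 2 * IZR m * l) / (2 * l)) = (m + 1)%Z).
    { symmetry; apply Int_part_spec; rewrite Hd, Hs, plus_IZR.
      replace (2 * l / (2 * l)) with 1 by (field; lra). lra. }
    rewrite E, plus_IZR, Hs.
    replace (2 * l + 2 * IZR m * l - 2 * (IZR m + 1) * l) with 0 by ring.
    unfold reflect_angle.
    destruct (Rle_dec 0 l); destruct (Rle_dec (2 * l) l); try lra.
    replace (2 * l - 2 * l) with 0 by ring. rewrite H0. lra.
Qed.

(* [eps0] and [th] are the branches: [th N e] is the tangent angle on [0, l]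
   of the arc with parameter [e] on the N-th branch, |e| < eps0 N. *)
Definition circular_wave (l : R) (eps0 : nat -> R) (th : nat -> R -> R -> R)
    (g : curve) : Prop :=
  exists (N : nat) (e rho : R),
    0 < Rabs e < eps0 N /\ 0 < rho /\
    forall s, g s = dilate rho (wave l N (th N e)) s.

(* Main.v *)
(** The angle [phi = theta - PI/2] of the arc is an odd solution of [phi'''' = - c sin phi] with
    [phi = (2N+1) PI] and [phi'' = 0] at [s = l].  Writing [phi = A s + angle(A s)] with
    [A = (2N+1) PI / l] and [c = A^4 mu], the perturbation [angle] is an odd 2 PI-periodic solution
    of [angle'''' = - mu sin (x + angle)], which involves neither [l] nor [N]: every branch is a
    rescaling of one universal family.  Inverting the fourth derivative on odd 2 PI-periodic
    functions makes this a fixed-point equation for [angle]; its formal solution in powers of [mu]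
    converges uniformly in [x], which gives the smooth dependence on the parameter.  Since
    [epsilon = A^3 angle'''(PI)] has derivative [- A^3] in [mu] at [mu = 0], the scalar inverse
    function theorem turns [mu] into a function of [epsilon].  The expansions
    [lambda = A^4 (5/4 mu^2 + ...)] and [int_0^PI cos (x + angle) = PI/2 mu + ...] give the
    positivity of [lambda] and the nonzero translation period.  Finally a congruence preserves the
    curvature up to sign, here positive, hence also the mean turning rate; in (iv) the rate of the
    dilated wave is determined by [mu], so it suffices to choose the parameters one after the
    other with distinct values of [lambda / A^4]. *)

Require Import Defs.
From Stdlib Require Import Reals ZArith Lra Lia IndefiniteDescription.
From Coquelicot Require Import Coquelicot.
Open Scope R_scope.

(** * Smooth functions on a set *)

(** The obstacle is the convergence of the formal solution. Sine and cosine of x + u are expanded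
    jointly, through the linear system they satisfy in [mu], so that each new coefficient is a
    Cauchy product of earlier ones. A plain geometric bound does not reproduce itself under such
    products; weighted with 1 / (n + 1)^2 it does. The ratio 8192 = 32 * 32 * 8 combines two
    applications of [dprim], at 32 each, with the constant 8 of the weighted convolution. A solution
    that is periodic on the whole line also disposes of the extension by reflection: the extended
    angle is that solution itself, so no derivatives have to be matched at the junctions.
    Stationarity is stated with four nested arclength derivatives. In terms of the tangent angle the
    equation factors as curvature times a first integral, and the vanishing of this integral at s =
    0 is the relation c = a b + lambda. *)

(** The derivative is an existential witness rather than [Derive_n], so closure under products and
    composition is a plain induction on the order. The outermost quantifier peels the innermost
    derivative. *)
Fixpoint diff_on (n : nat) (D : R -> Prop) (f : R -> R) : Prop :=
  match n with
  | O => True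
  | S m => exists f', (forall x, D x -> is_derive f x (f' x)) /\ diff_on m D f'
  end.

Lemma diff_on_pred (n : nat) (D : R -> Prop) (f : R -> R) :
  diff_on (S n) D f -> diff_on n D f.
Proof.
  revert f; induction n as [|n IH]; intros f [f' [H1 H2]]; [exact I|].
  exists f'; split; [exact H1 | now apply IH].
Qed.

Lemma diff_on_const (n : nat) (D : R -> Prop) (c : R) : diff_on n D (fun _ => c).
Proof.
  revert c; induction n as [|n IH]; intros c; [exact I|].
  exists (fun _ => 0); split; [|apply IH].
  intros x _; auto_derive; trivial.
Qed.

Lemma diff_on_id (n : nat) (D : R -> Prop) : diff_on n D (fun x => x).
Proof.
  destruct n as [|n]; [exact I|].
  exists (fun _ => 1); split; [|apply diff_on_const].
  intros x _; auto_derive; trivial.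
Qed.

Lemma diff_on_plus (n : nat) (D : R -> Prop) (f g : R -> R) :
  diff_on n D f -> diff_on n D g -> diff_on n D (fun x => f x + g x).
Proof.
  revert f g; induction n as [|n IH]; intros f g; [easy|].
  intros [f' [F1 F2]] [g' [G1 G2]].
  exists (fun x => f' x + g' x); split; [|now apply IH].
  intros x Hx; apply (is_derive_plus f g); auto.
Qed.

Lemma diff_on_mult (n : nat) (D : R -> Prop) (f g : R -> R) :
  diff_on n D f -> diff_on n D g -> diff_on n D (fun x => f x * g x).
Proof.
  revert f g; induction n as [|n IH]; intros f g; [easy|].
  intros Hf Hg.
  pose proof (diff_on_pred _ _ _ Hf) as Hf0.
  pose proof (diff_on_pred _ _ _ Hg) as Hg0.
  destruct Hf as [f' [F1 F2]]; destruct Hg as [g' [G1 G2]].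
  exists (fun x => f' x * g x + f x * g' x); split.
  - intros x Hx; apply (is_derive_mult f g); auto; intros; apply Rmult_comm.
  - apply diff_on_plus; apply IH; assumption.
Qed.

Lemma diff_on_comp (n : nat) (D E : R -> Prop) (f g : R -> R) :
  (forall x, D x -> E (g x)) ->
  diff_on n E f -> diff_on n D g -> diff_on n D (fun x => f (g x)).
Proof.
  intros HDE; revert f; induction n as [|n IH]; intros f Hf Hg; [exact I|].
  pose proof (diff_on_pred _ _ _ Hg) as Hg0.
  destruct Hf as [f' [F1 F2]]; destruct Hg as [g' [G1 G2]].
  exists (fun x => g' x * f' (g x)); split.
  - intros x Hx; apply (is_derive_comp f g); auto.
  - apply diff_on_mult; auto.
Qed.

Lemma diff_on_inv (n : nat) (D : R -> Prop) (f : R -> R) :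
  (forall x, D x -> f x <> 0) -> diff_on n D f -> diff_on n D (fun x => / f x).
Proof.
  intros H0; induction n as [|n IH]; intros Hf; [exact I|].
  pose proof (diff_on_pred _ _ _ Hf) as Hf0.
  destruct Hf as [f' [F1 F2]].
  (* The square is written with two factors [/ f x], so that the induction hypothesis applies to
     each of them. *)
  exists (fun x => ((-1) * f' x) * (/ f x * / f x)); split.
  - intros x Hx.
    replace ((-1) * f' x * (/ f x * / f x)) with (- f' x / f x ^ 2) by (field; auto).
    apply is_derive_inv; auto.
  - repeat apply diff_on_mult; auto. apply diff_on_const.
Qed.

(** [diff_on] differentiates f first, whereas [ex_derive_n] asks for the derivative of
    [Derive_n f n]; [Derive_n_comp] exchanges the two. Openness makes the witness agree with
    [Derive f] near the point. *)
Lemma diff_on_ex_derive_n (D : R -> Prop) (f : R -> R) (n : nat) (x : R) :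
  open D -> diff_on n D f -> D x -> ex_derive_n f n x.
Proof.
  intros HD; revert f x; induction n as [|n IH]; intros f x Hf Hx; [exact I|].
  destruct Hf as [f' [F1 F2]].
  assert (Hloc : locally x (fun y => f' y = Derive f y)).
  { apply (filter_imp D); [|now apply HD].
    intros y Hy; symmetry; apply is_derive_unique; auto. }
  destruct n as [|n]; [exists (f' x); auto|].
  assert (G : ex_derive_n (Derive f) (S n) x)
    by (apply (ex_derive_n_ext_loc f'); auto).
  simpl in G |- *.
  eapply ex_derive_ext; [|exact G].
  intros t; transitivity (Derive_n f (n + 1) t).
  - exact (Derive_n_comp f n 1 t).
  - now rewrite Nat.add_1_r.
Qed.

Lemma diff_on_PSeries (n : nat) (u : nat -> R) (r : R) :
  Rbar_le r (CV_radius u) -> diff_on n (fun x => Rabs x < r) (PSeries u).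
Proof.
  revert u; induction n as [|n IH]; intros u Hu; [exact I|].
  exists (PSeries (PS_derive u)); split.
  - intros x Hx; apply is_derive_PSeries.
    now apply Rbar_lt_le_trans with r.
  - apply IH; now rewrite CV_radius_derive.
Qed.

(** * Primitives of odd and even periodic functions *)

Lemma derive_zero_const (f : R -> R) :
  (forall x, is_derive f x 0) -> forall x y, f x = f y.
Proof.
  intros H.
  assert (G : forall x y, x < y -> f x = f y)
    by (intros x y Hxy; apply (eq_is_derive f x y); auto).
  intros x y; destruct (Rtotal_order x y) as [L|[E|L]].
  - now apply G.
  - now rewrite E.
  - symmetry; now apply G.
Qed.

Lemma is_derive_continuous (f : R -> R) (x d : R) : is_derive f x d -> continuous f x.
Proof. intros H; apply (ex_derive_continuous f); now exists d. Qed.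

Lemma is_derive_reflect (f : R -> R) (x d : R) :
  is_derive f (- x) d -> is_derive (fun y => f (- y)) x (- d).
Proof.
  intros H; replace (- d) with (scal (-1) d) by (compute; ring).
  apply (is_derive_comp f Ropp); [exact H | auto_derive; trivial].
Qed.

Lemma is_derive_affine (f : R -> R) (a b x d : R) :
  is_derive f (a * x + b) d -> is_derive (fun y => f (a * y + b)) x (a * d).
Proof.
  intros H; apply (is_derive_comp f (fun y => a * y + b)); [exact H|].
  auto_derive; [trivial | ring].
Qed.

Lemma is_derive_shift (f : R -> R) (b x d : R) :
  is_derive f (x + b) d -> is_derive (fun y => f (y + b)) x d.
Proof.
  intros H; replace d with (scal 1 d) by (compute; ring).
  apply (is_derive_comp f (fun y => y + b)); [exact H|].
  auto_derive; [trivial | ring].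
Qed.

Lemma Rabs_sub_le_of_derive (f f' : R -> R) (B x y : R) :
  (forall z, is_derive f z (f' z)) -> (forall z, Rabs (f' z) <= B) ->
  Rabs (f y - f x) <= B * Rabs (y - x).
Proof.
  intros D HB.
  destruct (MVT_gen f x y f') as [c [_ E]].
  - intros; apply D.
  - intros z _; apply continuity_pt_filterlim.
    now apply (is_derive_continuous f z (f' z)).
  - rewrite E, Rabs_mult. apply Rmult_le_compat_r; [apply Rabs_pos | apply HB].
Qed.

(** Oddness and periodicity together force zeros at 0 and at PI; the conditions at both ends of the
    arc are thus built into the function class. *)
Definition odd_periodic (f : R -> R) : Prop :=
  (forall x, continuous f x) /\ (forall x, f (- x) = - f x) /\
  (forall x, f (x + 2 * PI) = f x).

Definition even_periodic (f : R -> R) : Prop :=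
  (forall x, continuous f x) /\ (forall x, f (- x) = f x) /\
  (forall x, f (x + 2 * PI) = f x).

Lemma shift_iter (f : R -> R) (T d : R) (n : nat) (x : R) :
  (forall y, f (y + T) = f y + d) -> f (x + INR n * T) = f x + INR n * d.
Proof.
  intros H; induction n as [|n IH].
  - simpl; rewrite !Rmult_0_l, !Rplus_0_r; reflexivity.
  - rewrite S_INR.
    replace (x + (INR n + 1) * T) with (x + INR n * T + T) by ring.
    rewrite H, IH; ring.
Qed.

(** The increment d serves three uses: periodic functions (d = 0), the tangent angle, and the
    coordinates of a curve that repeats up to translation. *)
Lemma shift_reduce (f : R -> R) (T d x0 : R) :
  0 < T -> (forall y, f (y + T) = f y + d) ->
  forall x, exists (m : Z) y,
    x0 <= y <= x0 + T /\ x = y + IZR m * T /\ f x = f y + IZR m * d.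
Proof.
  intros HT H x.
  assert (Hz : forall m y, f (y + IZR m * T) = f y + IZR m * d).
  { intros m y; destruct (Z_le_dec 0 m) as [L|L].
    - rewrite <- (Z2Nat.id m L), <- INR_IZR_INZ. now apply shift_iter.
    - replace m with (- Z.of_nat (Z.to_nat (- m)))%Z by lia.
      rewrite opp_IZR, <- INR_IZR_INZ.
      pose proof (shift_iter f T d (Z.to_nat (- m)) (y + - INR (Z.to_nat (- m)) * T) H) as G.
      replace (y + - INR (Z.to_nat (- m)) * T + INR (Z.to_nat (- m)) * T) with y in G by ring.
      lra. }
  destruct (floor_ex ((x - x0) / T)) as [m [M1 M2]].
  exists m, (x - IZR m * T).
  assert (E : x - x0 = (x - x0) / T * T) by (field; lra).
  split; [|split].
  - assert (0 <= ((x - x0) / T - IZR m) * T) by (apply Rmult_le_pos; lra).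
    assert (((x - x0) / T - IZR m) * T <= 1 * T) by (apply Rmult_le_compat_r; lra).
    lra.
  - ring.
  - rewrite <- Hz; f_equal; ring.
Qed.

(** The window contains the period from - PI to PI because PI <= 4; the bound 4 keeps all later
    constants integers. *)
Lemma periodic_bound (f : R -> R) (B : R) :
  (forall x, f (x + 2 * PI) = f x) ->
  (forall x, Rabs x <= 4 -> Rabs (f x) <= B) -> forall x, Rabs (f x) <= B.
Proof.
  intros Hp HB x.
  pose proof PI_RGT_0; pose proof PI_4.
  destruct (shift_reduce f (2 * PI) 0 (- PI)) with (x := x) as [m [y [Hy [_ E]]]].
  - lra.
  - intros z; rewrite Hp; ring.
  - rewrite E, Rmult_0_r, Rplus_0_r. apply HB. apply Rabs_le; lra.
Qed.

Definition prim (f : R -> R) (x : R) : R := RInt f 0 x.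

(* The primitive whose mean over [0, PI] vanishes. *)
Definition prim0 (f : R -> R) (x : R) : R := prim f x - prim (prim f) PI / PI.

Lemma prim_derive (f : R -> R) (x : R) :
  (forall y, continuous f y) -> is_derive (prim f) x (f x).
Proof.
  intros Hf; apply (is_derive_RInt f (prim f) 0 x); [|apply Hf].
  apply filter_forall; intros y; apply (RInt_correct f).
  apply (ex_RInt_continuous f); auto.
Qed.

Lemma prim_zero (f : R -> R) : prim f 0 = 0.
Proof. apply (RInt_point 0 f). Qed.

Lemma prim_unique (f F : R -> R) :
  (forall x, continuous f x) -> (forall x, is_derive F x (f x)) ->
  forall x, prim f x = F x - F 0.
Proof.
  intros Hf HF x.
  assert (H : prim f x - F x = prim f 0 - F 0).
  { apply (derive_zero_const (fun y => prim f y - F y)).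
    intros y; replace 0 with (minus (f y) (f y)) by (compute; ring).
    apply (is_derive_minus (prim f) F); auto using prim_derive. }
  rewrite prim_zero in H; lra.
Qed.

Lemma prim0_derive (f : R -> R) (x : R) :
  (forall y, continuous f y) -> is_derive (prim0 f) x (f x).
Proof.
  intros Hf; replace (f x) with (minus (f x) 0) by (compute; ring).
  apply (is_derive_minus (prim f) (fun _ => prim (prim f) PI / PI)).
  - now apply prim_derive.
  - auto_derive; trivial.
Qed.

Lemma prim_continuous (f : R -> R) :
  (forall y, continuous f y) -> forall x, continuous (prim f) x.
Proof. intros Hf x; eapply is_derive_continuous; now apply prim_derive. Qed.

Lemma prim0_continuous (f : R -> R) :
  (forall y, continuous f y) -> forall x, continuous (prim0 f) x.
Proof. intros Hf x; eapply is_derive_continuous; now apply prim0_derive. Qed.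

(** Antiderivatives differ by a constant, which the vanishing mean fixes. This evaluates [prim0] on
    explicit trigonometric functions. *)
Lemma prim0_unique (f F : R -> R) :
  (forall x, continuous f x) -> (forall x, is_derive F x (f x)) ->
  prim F PI = 0 -> forall x, prim0 f x = F x.
Proof.
  intros Hf HF Hm x.
  assert (HFc : forall y, continuous F y)
    by (intros y; eapply is_derive_continuous; apply HF).
  unfold prim0.
  assert (E : prim (prim f) PI = prim F PI - F 0 * PI).
  { rewrite (prim_unique (prim f) (fun y => prim F y - F 0 * y)).
    - rewrite prim_zero; ring.
    - now apply prim_continuous.
    - intros y; rewrite (prim_unique f F) by assumption.
      apply (is_derive_minus (prim F) (fun y => F 0 * y)).
      + now apply prim_derive.
      + auto_derive; [trivial | ring]. }
  rewrite E, Hm, (prim_unique f F) by assumption.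
  pose proof PI_RGT_0; field; lra.
Qed.

Lemma prim0_mean (f : R -> R) : (forall x, continuous f x) -> prim (prim0 f) PI = 0.
Proof.
  intros Hf; set (m := prim (prim f) PI / PI).
  rewrite (prim_unique (prim0 f) (fun x => prim (prim f) x - m * x)).
  - rewrite prim_zero; unfold m; pose proof PI_RGT_0; field; lra.
  - now apply prim0_continuous.
  - intros x; apply (is_derive_minus (prim (prim f)) (fun x => m * x)).
    + apply prim_derive; now apply prim_continuous.
    + auto_derive; [trivial | fold m; ring].
Qed.

(** The primitive F of an odd function is even, so F(PI) = F(- PI): the integral over a period
    vanishes and F is periodic. *)
Lemma prim_even_periodic (f : R -> R) : odd_periodic f -> even_periodic (prim f).
Proof.
  intros [Hc [Ho Hp]].
  assert (He : forall x, prim f (- x) = prim f x).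
  { intros x.
    enough (H : prim f (- x) - prim f x = prim f (- 0) - prim f 0).
    { rewrite Ropp_0, !prim_zero in H; lra. }
    apply (derive_zero_const (fun y => prim f (- y) - prim f y)); intros y.
    replace 0 with (minus (- f (- y)) (f y)) by (rewrite Ho; compute; ring).
    apply (is_derive_minus (fun y => prim f (- y)) (prim f)).
    - apply is_derive_reflect, prim_derive, Hc.
    - apply prim_derive, Hc. }
  split; [now apply prim_continuous | split; [exact He|]].
  intros x.
  enough (H : prim f (x + 2 * PI) - prim f x = prim f (- PI + 2 * PI) - prim f (- PI)).
  { rewrite He in H; replace (- PI + 2 * PI) with PI in H by ring; lra. }
  apply (derive_zero_const (fun y => prim f (y + 2 * PI) - prim f y)); intros y.
  replace 0 with (minus (f (y + 2 * PI)) (f y)) by (rewrite Hp; compute; ring).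
  apply (is_derive_minus (fun y => prim f (y + 2 * PI)) (prim f)).
  - apply is_derive_shift, prim_derive, Hc.
  - apply prim_derive, Hc.
Qed.

Lemma prim_even_odd (f : R -> R) : even_periodic f -> forall x, prim f (- x) = - prim f x.
Proof.
  intros [Hc [He _]] x.
  enough (H : prim f (- x) + prim f x = prim f (- 0) + prim f 0).
  { rewrite Ropp_0, !prim_zero in H; lra. }
  apply (derive_zero_const (fun y => prim f (- y) + prim f y)); intros y.
  replace 0 with (plus (- f (- y)) (f y)) by (rewrite He; compute; ring).
  apply (is_derive_plus (fun y => prim f (- y)) (prim f)).
  - apply is_derive_reflect, prim_derive, Hc.
  - apply prim_derive, Hc.
Qed.

(** The increment is the integral over one period, twice the integral over half of it by symmetry.
    It becomes the translation period of the wave. *)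
Lemma prim_even_shift (f : R -> R) :
  even_periodic f -> forall x, prim f (x + 2 * PI) = prim f x + 2 * prim f PI.
Proof.
  intros Hf x; pose proof (prim_even_odd f Hf) as Ho.
  destruct Hf as [Hc [_ Hp]].
  enough (H : prim f (x + 2 * PI) - prim f x = prim f (- PI + 2 * PI) - prim f (- PI)).
  { rewrite Ho in H; replace (- PI + 2 * PI) with PI in H by ring; lra. }
  apply (derive_zero_const (fun y => prim f (y + 2 * PI) - prim f y)); intros y.
  replace 0 with (minus (f (y + 2 * PI)) (f y)) by (rewrite Hp; compute; ring).
  apply (is_derive_minus (fun y => prim f (y + 2 * PI)) (prim f)).
  - apply is_derive_shift, prim_derive, Hc.
  - apply prim_derive, Hc.
Qed.

Lemma prim_odd_periodic (f : R -> R) :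
  even_periodic f -> prim f PI = 0 -> odd_periodic (prim f).
Proof.
  intros Hf Hm; split; [apply prim_continuous, Hf | split].
  - now apply prim_even_odd.
  - intros x; rewrite prim_even_shift, Hm by assumption; ring.
Qed.

Lemma prim0_even_periodic (f : R -> R) : odd_periodic f -> even_periodic (prim0 f).
Proof.
  intros Hf; destruct (prim_even_periodic f Hf) as [_ [He Hp]].
  destruct Hf as [Hc _].
  split; [now apply prim0_continuous|].
  split; intros x; unfold prim0; [now rewrite He | now rewrite Hp].
Qed.

(* On odd 2 PI-periodic functions this inverts the second derivative. *)
Definition dprim (f : R -> R) : R -> R := prim (prim0 f).

Lemma dprim_odd_periodic (f : R -> R) : odd_periodic f -> odd_periodic (dprim f).
Proof.
  intros Hf; apply prim_odd_periodic.
  - now apply prim0_even_periodic.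
  - apply prim0_mean, Hf.
Qed.

Lemma prim_bound (f : R -> R) (B x : R) :
  (forall y, continuous f y) -> (forall y, Rabs (f y) <= B) ->
  Rabs x <= 4 -> Rabs (prim f x) <= 4 * B.
Proof.
  intros Hc HB Hx.
  assert (0 <= B) by (eapply Rle_trans; [apply Rabs_pos | apply (HB 0)]).
  pose proof (Rabs_sub_le_of_derive (prim f) f B 0 x
                (fun z => prim_derive f z Hc) HB) as H1.
  rewrite prim_zero, !Rminus_0_r in H1.
  nra.
Qed.

Lemma prim_bound_odd (f : R -> R) (B : R) :
  odd_periodic f -> (forall y, Rabs (f y) <= B) ->
  forall x, Rabs (prim f x) <= 4 * B.
Proof.
  intros Hf HB; apply periodic_bound.
  - apply prim_even_periodic, Hf.
  - intros x; apply prim_bound; [apply Hf | exact HB].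
Qed.

(** The primitive is bounded by 4 B, and so is its mean that is subtracted. *)
Lemma prim0_bound (f : R -> R) (B : R) :
  odd_periodic f -> (forall y, Rabs (f y) <= B) ->
  forall x, Rabs (prim0 f x) <= 8 * B.
Proof.
  intros Hf HB x; unfold prim0.
  pose proof (prim_bound_odd f B Hf HB x) as H1.
  assert (H2 : Rabs (prim (prim f) PI) <= 4 * B * PI).
  { pose proof (Rabs_sub_le_of_derive (prim (prim f)) (prim f) (4 * B) 0 PI) as H.
    rewrite prim_zero, !Rminus_0_r, (Rabs_right PI) in H
      by (pose proof PI_RGT_0; lra).
    apply H; [|now apply prim_bound_odd].
    intros z; apply prim_derive, prim_continuous, Hf. }
  assert (H3 : Rabs (prim (prim f) PI / PI) <= 4 * B).
  { pose proof PI_RGT_0. unfold Rdiv; rewrite Rabs_mult, Rabs_inv, (Rabs_right PI) by lra.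
    apply (Rmult_le_reg_r PI); [lra|]. rewrite Rmult_assoc, Rinv_l; lra. }
  eapply Rle_trans; [apply Rabs_triang|]. rewrite Rabs_Ropp; lra.
Qed.

(** The constant is 4 for the outer primitive times 8 for [prim0]. *)
Lemma dprim_bound (f : R -> R) (B : R) :
  odd_periodic f -> (forall y, Rabs (f y) <= B) ->
  forall x, Rabs (dprim f x) <= 32 * B.
Proof.
  intros Hf HB; apply periodic_bound.
  - now apply dprim_odd_periodic.
  - intros x Hx; replace (32 * B) with (4 * (8 * B)) by ring.
    apply prim_bound; [|now apply prim0_bound | exact Hx].
    apply prim0_continuous, Hf.
Qed.

Lemma odd_periodic_at_PI (f : R -> R) : odd_periodic f -> f PI = 0.
Proof.
  intros [_ [Ho Hp]]; specialize (Ho PI); specialize (Hp (- PI)).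
  replace (- PI + 2 * PI) with PI in Hp by ring; lra.
Qed.

Lemma odd_periodic_at_0 (f : R -> R) : odd_periodic f -> f 0 = 0.
Proof. intros [_ [Ho _]]; specialize (Ho 0); rewrite Ropp_0 in Ho; lra. Qed.

Lemma prim_ext (f g : R -> R) : (forall x, f x = g x) -> forall x, prim f x = prim g x.
Proof. intros H x; apply RInt_ext; auto. Qed.

Lemma prim0_ext (f g : R -> R) : (forall x, f x = g x) -> forall x, prim0 f x = prim0 g x.
Proof.
  intros H x; unfold prim0; f_equal; [now apply prim_ext|].
  f_equal; apply prim_ext; intros y; now apply prim_ext.
Qed.

Lemma dprim_ext (f g : R -> R) : (forall x, f x = g x) -> forall x, dprim f x = dprim g x.
Proof. intros H; apply prim_ext, prim0_ext, H. Qed.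

(** * Geometrically bounded series *)

Lemma CV_radius_ge (a : nat -> R) (B R0 r : R) :
  0 < r -> r * R0 <= 1 -> 0 <= R0 -> (forall n, Rabs (a n) <= B * R0 ^ n) ->
  Rbar_le r (CV_radius a).
Proof.
  intros Hr HR HR0 Ha; apply (CV_radius_bounded a); exists B; intros n.
  assert (HB : 0 <= B).
  { specialize (Ha 0%nat); simpl in Ha; pose proof (Rabs_pos (a 0%nat)); lra. }
  rewrite Rabs_mult, <- RPow_abs, (Rabs_right r) by lra.
  apply Rle_trans with (B * R0 ^ n * r ^ n).
  - apply Rmult_le_compat_r; [apply pow_le; lra | apply Ha].
  - rewrite Rmult_assoc, <- Rpow_mult_distr.
    rewrite <- (Rmult_1_r B) at 2.
    apply Rmult_le_compat_l; [exact HB|].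
    rewrite <- (pow1 n); apply pow_incr; split; [nra | lra].
Qed.

Section GeometricSeries.

Variables (R0 mu : R).
Hypotheses (HR0 : 0 < R0) (Hmu : Rabs mu * R0 < 1).

Lemma in_radius (a : nat -> R) (B : R) :
  (forall n, Rabs (a n) <= B * R0 ^ n) -> Rbar_lt (Rabs mu) (CV_radius a).
Proof.
  intros Ha; apply Rbar_lt_le_trans with (/ R0).
  - simpl; apply (Rmult_lt_reg_r R0); [lra|]. rewrite Rinv_l; lra.
  - apply CV_radius_ge with B R0; auto; try lra.
    + now apply Rinv_0_lt_compat.
    + rewrite Rinv_l; lra.
Qed.

(** The remainder depends on the coefficients only through [B] and [R0]. For coefficients that are
    functions of x it is therefore uniform in x, which yields both continuity and termwise
    integration. *)
Lemma PSeries_tail (a : nat -> R) (B : R) (n : nat) :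
  (forall k, Rabs (a k) <= B * R0 ^ k) ->
  Rabs (PSeries a mu - sum_n (fun k => a k * mu ^ k) n)
    <= B * (Rabs mu * R0) ^ S n / (1 - Rabs mu * R0).
Proof.
  intros Ha; set (q := Rabs mu * R0) in *.
  assert (Hq : 0 <= q) by (apply Rmult_le_pos; [apply Rabs_pos | lra]).
  assert (Hk : forall k, Rabs (a k * mu ^ k) <= B * q ^ k).
  { intros k; unfold q; rewrite Rabs_mult, <- RPow_abs, Rpow_mult_distr.
    replace (B * (Rabs mu ^ k * R0 ^ k)) with (B * R0 ^ k * Rabs mu ^ k) by ring.
    apply Rmult_le_compat_r; [apply pow_le, Rabs_pos | apply Ha]. }
  assert (Hg : ex_series (fun k => B * q ^ (S n + k))).
  { apply ex_series_ext with (fun k => scal (B * q ^ S n) (q ^ k)).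
    - intros k; rewrite pow_add; compute; ring.
    - apply @ex_series_scal, ex_series_geom; rewrite Rabs_right; lra. }
  assert (Hex : ex_series (fun k => a k * mu ^ k)).
  { assert (E := CV_radius_inside a mu (in_radius a B Ha)).
    apply ex_series_ext with (2 := E); intros k. rewrite pow_n_pow; compute; ring. }
  unfold PSeries. rewrite (Series_incr_n _ (S n)) by (auto; lia).
  rewrite sum_n_Reals; simpl pred.
  replace (_ + _ - _) with (Series (fun k => a (S n + k)%nat * mu ^ (S n + k))) by ring.
  assert (Hex2 : ex_series (fun k => Rabs (a (S n + k)%nat * mu ^ (S n + k)))).
  { eapply (ex_series_le (V := R_CompleteNormedModule)); [|exact Hg].
    intros k; simpl; change (Rabs (Rabs (a (S n + k)%nat * mu ^ (S n + k))) <= B * q ^ (S n + k)).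
    rewrite Rabs_Rabsolu; apply Hk. }
  eapply Rle_trans; [apply Series_Rabs, Hex2|].
  eapply Rle_trans.
  - apply Series_le with (2 := Hg); intros k; split; [apply Rabs_pos | apply Hk].
  - rewrite (Series_ext _ (fun k => (B * q ^ S n) * q ^ k))
      by (intros k; rewrite pow_add; ring).
    rewrite Series_scal_l, Series_geom by (rewrite Rabs_right; lra).
    right; unfold Rdiv; ring.
Qed.

Lemma tail_lim (B : R) :
  is_lim_seq (fun n => B * (Rabs mu * R0) ^ S n / (1 - Rabs mu * R0)) 0.
Proof.
  replace (Finite 0) with (Rbar_mult (B * (Rabs mu * R0) / (1 - Rabs mu * R0)) 0)
    by (simpl; f_equal; ring).
  apply is_lim_seq_ext with
    (fun n => B * (Rabs mu * R0) / (1 - Rabs mu * R0) * (Rabs mu * R0) ^ n).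
  - intros n; simpl; field; lra.
  - apply is_lim_seq_scal_l, is_lim_seq_geom.
    rewrite Rabs_right; [exact Hmu|].
    apply Rle_ge, Rmult_le_pos; [apply Rabs_pos | lra].
Qed.

Variables (F : nat -> R -> R) (B : R).
Hypotheses (Fc : forall n x, continuous (F n) x)
           (FB : forall n x, Rabs (F n x) <= B * R0 ^ n).

Let f (x : R) : R := PSeries (fun n => F n x) mu.
Let fn (n : nat) (x : R) : R := sum_n (fun k => F k x * mu ^ k) n.

Lemma partial_sum_continuous (n : nat) (x : R) : continuous (fn n) x.
Proof.
  unfold fn; induction n as [|n IH].
  - apply continuous_ext with (fun x => F 0%nat x * mu ^ 0).
    + intros y; now rewrite sum_O.
    + apply (continuous_mult (F 0%nat) (fun _ => mu ^ 0)); [apply Fc | apply continuous_const].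
  - apply continuous_ext with
      (fun x => plus (sum_n (fun k => F k x * mu ^ k) n) (F (S n) x * mu ^ S n)).
    + intros y; now rewrite sum_Sn.
    + apply (continuous_plus (fun x => sum_n (fun k => F k x * mu ^ k) n)); [exact IH|].
      apply (continuous_mult (F (S n)) (fun _ => mu ^ S n)); [apply Fc | apply continuous_const].
Qed.

(** Uniform limit of continuous partial sums, by the usual argument with three thirds of epsilon. *)
Lemma series_continuous (x : R) : continuous f x.
Proof.
  apply filterlim_locally; intros eps.
  assert (He : 0 < eps / 3) by (destruct eps; simpl; lra).
  destruct (proj2 (is_lim_seq_spec _ _) (tail_lim B) (mkposreal _ He)) as [n Hn].
  specialize (Hn n (le_n n)); simpl in Hn; rewrite Rminus_0_r in Hn.
  apply Rabs_def2 in Hn.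
  generalize (proj1 (filterlim_locally _ _) (partial_sum_continuous n x) (mkposreal _ He)).
  apply filter_imp; intros y Hy.
  change (Rabs (fn n y - fn n x) < eps / 3) in Hy.
  change (Rabs (f y - f x) < eps).
  pose proof (PSeries_tail (fun k => F k x) B n (fun k => FB k x)) as Tx.
  pose proof (PSeries_tail (fun k => F k y) B n (fun k => FB k y)) as Ty.
  change (Rabs (f x - fn n x) <= B * (Rabs mu * R0) ^ S n / (1 - Rabs mu * R0)) in Tx.
  change (Rabs (f y - fn n y) <= B * (Rabs mu * R0) ^ S n / (1 - Rabs mu * R0)) in Ty.
  apply Rabs_def2 in Hy. apply Rabs_le_between in Tx. apply Rabs_le_between in Ty.
  simpl in Tx, Ty.
  apply Rabs_def1; lra.
Qed.

Lemma prim_partial_sum (n : nat) (y : R) :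
  prim (fn n) y = sum_n (fun k => prim (F k) y * mu ^ k) n.
Proof.
  enough (D : forall x, is_derive (fun x => sum_n (fun k => prim (F k) x * mu ^ k) n) x (fn n x)).
  { rewrite (prim_unique (fn n) _ (partial_sum_continuous n) D).
    replace (sum_n (fun k => prim (F k) 0 * mu ^ k) n) with 0; [ring|].
    rewrite (sum_n_ext _ (fun _ => 0)) by (intros k; rewrite prim_zero; apply Rmult_0_l).
    rewrite sum_n_const; ring. }
  intros x; unfold fn; induction n as [|n IH].
  - apply is_derive_ext with (fun x => prim (F 0%nat) x * mu ^ 0).
    + intros t; now rewrite sum_O.
    + rewrite sum_O. replace (F 0%nat x * mu ^ 0) with (scal (mu ^ 0) (F 0%nat x)) by (compute; ring).
      apply is_derive_ext with (fun x => scal (mu ^ 0) (prim (F 0%nat) x)).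
      { intros t; compute; ring. }
      apply (is_derive_scal (prim (F 0%nat))). now apply prim_derive.
  - apply is_derive_ext with
      (fun x => plus (sum_n (fun k => prim (F k) x * mu ^ k) n) (scal (mu ^ S n) (prim (F (S n)) x))).
    + intros t; rewrite sum_Sn; f_equal; apply Rmult_comm.
    + rewrite sum_Sn, (Rmult_comm (F (S n) x)).
      apply (is_derive_plus (fun x => sum_n (fun k => prim (F k) x * mu ^ k) n)); [exact IH|].
      apply (is_derive_scal (prim (F (S n)))). now apply prim_derive.
Qed.

(** The difference between the primitives of the sum and of a partial sum has derivative bounded by
    the uniform remainder, so at y it is at most that remainder times |y|. *)
Lemma prim_series (y : R) : prim f y = PSeries (fun n => prim (F n) y) mu.
Proof.
  symmetry; apply is_pseries_unique.
  enough (H : is_lim_seq (sum_n (fun k => prim (F k) y * mu ^ k)) (prim f y)).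
  { eapply filterlim_ext; [|exact H]. intros n; apply sum_n_ext; intros k.
    rewrite Rmult_comm, <- (pow_n_pow mu k); reflexivity. }
  apply is_lim_seq_ext with (fun n => prim f y - (prim f y - prim (fn n) y)).
  { intros n; rewrite prim_partial_sum; ring. }
  replace (Finite (prim f y)) with (Finite (prim f y - 0)) by (f_equal; ring).
  apply is_lim_seq_minus'; [apply is_lim_seq_const|].
  apply is_lim_seq_abs_0.
  apply is_lim_seq_le_le with (fun _ => 0)
    (fun n => (B * (Rabs mu * R0) ^ S n / (1 - Rabs mu * R0)) * Rabs y).
  - intros n; split; [apply Rabs_pos|].
    pose proof (Rabs_sub_le_of_derive (fun y => prim f y - prim (fn n) y)
      (fun x => f x - fn n x) (B * (Rabs mu * R0) ^ S n / (1 - Rabs mu * R0)) 0 y) as H.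
    cbv beta in H; rewrite !prim_zero, !Rminus_0_r in H.
    apply H.
    + intros z; apply (is_derive_minus (prim f) (prim (fn n)));
        apply prim_derive; [apply series_continuous | apply partial_sum_continuous].
    + intros z; apply (PSeries_tail (fun k => F k z)); intros k; apply FB.
  - apply is_lim_seq_const.
  - replace (Finite 0) with (Rbar_mult 0 (Rabs y)) by (simpl; f_equal; ring).
    apply is_lim_seq_scal_r, tail_lim.
Qed.

End GeometricSeries.

Section OddPeriodicSeries.

Variables (R0 mu : R).
Hypotheses (HR0 : 0 < R0) (Hmu : Rabs mu * R0 < 1).
Variables (F : nat -> R -> R) (B : R).
Hypotheses (Fo : forall n, odd_periodic (F n))
           (FB : forall n x, Rabs (F n x) <= B * R0 ^ n).

Let f (x : R) : R := PSeries (fun n => F n x) mu.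

Lemma series_odd_periodic : odd_periodic f.
Proof.
  split; [|split].
  - apply (series_continuous R0 mu HR0 Hmu F B); [intros n; apply Fo | exact FB].
  - intros x; unfold f; rewrite <- PSeries_opp; apply PSeries_ext; intros n.
    unfold PS_opp; apply Fo.
  - intros x; apply PSeries_ext; intros n; apply Fo.
Qed.

Lemma prim0_series (y : R) : prim0 f y = PSeries (fun n => prim0 (F n) y) mu.
Proof.
  assert (Fc : forall n x, continuous (F n) x) by (intros n; apply Fo).
  assert (Pc : forall n x, continuous (prim (F n)) x) by (intros n; now apply prim_continuous).
  assert (PB : forall n x, Rabs (prim (F n) x) <= (4 * B) * R0 ^ n).
  { intros n x; rewrite Rmult_assoc; apply prim_bound_odd; auto. }
  assert (E : prim (prim f) PI = PSeries (fun n => prim (prim (F n)) PI) mu).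
  { rewrite <- (prim_series R0 mu HR0 Hmu (fun n => prim (F n)) (4 * B)) by assumption.
    apply prim_ext; intros x; now apply (prim_series R0 mu HR0 Hmu F B). }
  assert (EB : forall n, Rabs (prim (prim (F n)) PI) <= (16 * B) * R0 ^ n).
  { intros n; replace (16 * B * R0 ^ n) with (4 * (4 * B * R0 ^ n)) by ring.
    apply prim_bound; auto. pose proof PI_4; pose proof PI_RGT_0; apply Rabs_le; lra. }
  unfold prim0; rewrite E; unfold f; rewrite (prim_series R0 mu HR0 Hmu F B) by assumption.
  unfold Rdiv; rewrite Rmult_comm, <- PSeries_scal, <- PSeries_minus.
  - apply PSeries_ext; intros n; unfold PS_minus, PS_plus, PS_opp, PS_scal; compute; ring.
  - eapply CV_radius_inside, in_radius; eauto.
  - apply ex_pseries_scal; [apply Rmult_comm|].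
    eapply CV_radius_inside, in_radius; eauto.
Qed.

Lemma dprim_series (y : R) : dprim f y = PSeries (fun n => dprim (F n) y) mu.
Proof.
  unfold dprim.
  rewrite <- (prim_series R0 mu HR0 Hmu (fun n => prim0 (F n)) (8 * B)).
  - apply prim_ext, prim0_series.
  - intros n; apply prim0_continuous, Fo.
  - intros n x; rewrite Rmult_assoc; apply prim0_bound; auto.
Qed.

End OddPeriodicSeries.

(** * The coefficients of the solution *)

(** Telescoping: 1 / (x + 1)^2 <= 1 / x - 1 / (x + 1). *)
Lemma sum_inv_sq_le (n : nat) :
  sum_f_R0 (fun k => / (INR (S k)) ^ 2) n <= 2 - / INR (S n).
Proof.
  induction n as [|n IH]; [simpl; lra|].
  rewrite tech5.
  assert (H : 0 < INR (S n)) by (apply lt_0_INR; lia).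
  rewrite (S_INR (S n)); set (x := INR (S n)) in *.
  enough (/ (x + 1) ^ 2 <= / x - / (x + 1)) by lra.
  replace (/ x - / (x + 1)) with (/ (x * (x + 1))) by (field; lra).
  apply Rinv_le_contravar; nra.
Qed.

(** With a + b = n + 2, the inequality (a + b)^2 <= 2 (a^2 + b^2) gives 1 / (a^2 b^2) <= 2 (1 / a^2
    + 1 / b^2) / (a + b)^2. Each of the two sums of inverse squares is below 2, whence 8 = 2 * (2 +
    2). The weight is thus stable under Cauchy products. *)
Lemma conv_inv_sq_le (n : nat) :
  sum_f_R0 (fun k => / (INR (S k)) ^ 2 * / (INR (S (n - k))) ^ 2) n
    <= 8 / INR (S (S n)) ^ 2.
Proof.
  set (g := fun k : nat => / (INR (S k)) ^ 2).
  assert (Hn : 0 < INR (S (S n))) by (apply lt_0_INR; lia).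
  apply Rle_trans with
    (sum_f_R0 (fun k => (g k + g (n - k)%nat) * (2 / INR (S (S n)) ^ 2)) n).
  - apply sum_Rle; intros k Hk; unfold g.
    assert (Ha : 0 < INR (S k)) by (apply lt_0_INR; lia).
    assert (Hb : 0 < INR (S (n - k))) by (apply lt_0_INR; lia).
    replace (INR (S (S n))) with (INR (S k) + INR (S (n - k)))
      by (rewrite <- plus_INR; f_equal; lia).
    set (a := INR (S k)) in *; set (b := INR (S (n - k))) in *.
    assert (E : / a ^ 2 * / b ^ 2 = (a + b) ^ 2 * (/ (a ^ 2 * b ^ 2 * (a + b) ^ 2)))
      by (field; lra).
    assert (E2 : (/ a ^ 2 + / b ^ 2) * (2 / (a + b) ^ 2)
                 = (2 * (a ^ 2 + b ^ 2)) * (/ (a ^ 2 * b ^ 2 * (a + b) ^ 2)))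
      by (field; lra).
    rewrite E, E2. apply Rmult_le_compat_r.
    + left; apply Rinv_0_lt_compat; repeat apply Rmult_lt_0_compat; nra.
    + pose proof (pow2_ge_0 (a - b)); nra.
  - rewrite <- scal_sum, plus_sum.
    rewrite (sum_f_R0_skip g). pose proof (sum_inv_sq_le n) as H; fold g in H.
    assert (0 < / INR (S n)) by (apply Rinv_0_lt_compat, lt_0_INR; lia).
    replace (8 / INR (S (S n)) ^ 2) with (2 / INR (S (S n)) ^ 2 * 4) by (field; lra).
    apply Rmult_le_compat_l; [|lra].
    apply Rdiv_le_0_compat; [lra | nra].
Qed.

(* The coefficients in [mu] of the solution of [u = - mu * dprim (dprim (sin (x + u)))],
   given those of [sin (x + u)]. *)
Definition angle_coef (s : nat -> R -> R) (n : nat) (x : R) : R :=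
  match n with
  | O => 0
  | S m => - dprim (dprim (s m)) x
  end.

(* One coefficient of [S' = C u'], [C' = - S u'] (derivatives in [mu]), where
   [S = sin (x + u)] and [C = cos (x + u)]. *)
Definition conv_coef (s c : nat -> R -> R) (n : nat) (x : R) : R :=
  PS_mult (fun j => c j x) (PS_derive (fun j => angle_coef s j x)) n / INR (S n).

(** Coefficient n + 1 depends on all earlier coefficients of both families. Structural recursion
    therefore carries whole families: stage n is correct at indices up to n and holds meaningless
    values beyond. *)
Fixpoint trig_coefs (n : nat) : (nat -> R -> R) * (nat -> R -> R) :=
  match n with
  | O => (fun _ => sin, fun _ => cos)
  | S m =>
      let (s, c) := trig_coefs m in
      (fun j => if Nat.leb j m then s j else conv_coef s c m,
       fun j => if Nat.leb j m then c j else fun x => - conv_coef s s m x)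
  end.

Definition sin_coef (n : nat) : R -> R := fst (trig_coefs n) n.
Definition cos_coef (n : nat) : R -> R := snd (trig_coefs n) n.
Definition ang_coef : nat -> R -> R := angle_coef sin_coef.

Lemma trig_coefs_stable (n j : nat) : (j <= n)%nat ->
  fst (trig_coefs n) j = sin_coef j /\ snd (trig_coefs n) j = cos_coef j.
Proof.
  induction n as [|n IH]; intros Hj.
  - replace j with 0%nat by lia; split; reflexivity.
  - destruct (Nat.eq_dec j (S n)) as [->|N]; [split; reflexivity|].
    destruct IH as [I1 I2]; [lia|].
    simpl; destruct (trig_coefs n) as [s c]; simpl in *.
    rewrite (proj2 (Nat.leb_le j n)) by lia. now split.
Qed.

Lemma conv_coef_ext (s s' c c' : nat -> R -> R) (n : nat) (x : R) :
  (forall j, (j <= n)%nat -> s j = s' j) -> (forall j, (j <= n)%nat -> c j = c' j) ->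
  conv_coef s c n x = conv_coef s' c' n x.
Proof.
  intros Hs Hc; unfold conv_coef, PS_mult, PS_derive; apply (f_equal (fun z => z / INR (S n))).
  apply sum_eq; intros j Hj; cbn [angle_coef].
  rewrite (Hc j), (Hs (n - j)%nat) by lia; reflexivity.
Qed.

Lemma sin_coef_S (n : nat) (x : R) :
  sin_coef (S n) x = conv_coef sin_coef cos_coef n x.
Proof.
  unfold sin_coef at 1; pose proof (trig_coefs_stable n) as H; cbn [trig_coefs].
  destruct (trig_coefs n) as [s c]; cbn [fst snd] in *.
  rewrite (proj2 (Nat.leb_gt (S n) n)) by lia.
  apply conv_coef_ext; intros j Hj; now apply H.
Qed.

Lemma cos_coef_S (n : nat) (x : R) :
  cos_coef (S n) x = - conv_coef sin_coef sin_coef n x.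
Proof.
  unfold cos_coef at 1; pose proof (trig_coefs_stable n) as H; cbn [trig_coefs].
  destruct (trig_coefs n) as [s c]; cbn [fst snd] in *.
  rewrite (proj2 (Nat.leb_gt (S n) n)) by lia.
  apply Ropp_eq_compat, conv_coef_ext; intros j Hj; now apply H.
Qed.

(** * Parity and periodicity of the coefficients *)

Lemma odd_periodic_ext (f g : R -> R) :
  (forall x, f x = g x) -> odd_periodic f -> odd_periodic g.
Proof.
  intros E [Hc [Ho Hp]]; split; [|split].
  - intros x; now apply (continuous_ext f).
  - intros x; rewrite <- !E; apply Ho.
  - intros x; rewrite <- !E; apply Hp.
Qed.

Lemma even_periodic_ext (f g : R -> R) :
  (forall x, f x = g x) -> even_periodic f -> even_periodic g.
Proof.
  intros E [Hc [Ho Hp]]; split; [|split].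
  - intros x; now apply (continuous_ext f).
  - intros x; rewrite <- !E; apply Ho.
  - intros x; rewrite <- !E; apply Hp.
Qed.

Lemma odd_periodic_scal (a : R) (f : R -> R) :
  odd_periodic f -> odd_periodic (fun x => a * f x).
Proof.
  intros [Hc [Ho Hp]]; split; [|split].
  - intros x; apply (continuous_scal_r a f), Hc.
  - intros x; rewrite Ho; ring.
  - intros x; now rewrite Hp.
Qed.

Lemma even_periodic_scal (a : R) (f : R -> R) :
  even_periodic f -> even_periodic (fun x => a * f x).
Proof.
  intros [Hc [Ho Hp]]; split; [|split].
  - intros x; apply (continuous_scal_r a f), Hc.
  - intros x; now rewrite Ho.
  - intros x; now rewrite Hp.
Qed.

Lemma odd_periodic_mult (f g : R -> R) :
  even_periodic f -> odd_periodic g -> odd_periodic (fun x => f x * g x).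
Proof.
  intros [Hc [Ho Hp]] [Hc' [Ho' Hp']]; split; [|split].
  - intros x; apply (continuous_mult f g); auto.
  - intros x; rewrite Ho, Ho'; ring.
  - intros x; now rewrite Hp, Hp'.
Qed.

Lemma even_periodic_mult (f g : R -> R) :
  odd_periodic f -> odd_periodic g -> even_periodic (fun x => f x * g x).
Proof.
  intros [Hc [Ho Hp]] [Hc' [Ho' Hp']]; split; [|split].
  - intros x; apply (continuous_mult f g); auto.
  - intros x; rewrite Ho, Ho'; ring.
  - intros x; now rewrite Hp, Hp'.
Qed.

Lemma odd_periodic_sum (F : nat -> R -> R) (n : nat) :
  (forall k, (k <= n)%nat -> odd_periodic (F k)) ->
  odd_periodic (fun x => sum_f_R0 (fun k => F k x) n).
Proof.
  induction n as [|n IH]; intros H; [apply (H 0%nat); lia|].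
  destruct IH as [Hc [Ho Hp]]; [intros k Hk; apply H; lia|].
  destruct (H (S n) (le_n _)) as [Hc' [Ho' Hp']].
  split; [|split]; intros x; simpl.
  - apply (continuous_plus (fun x => sum_f_R0 (fun k => F k x) n)); auto.
  - rewrite Ho, Ho'; ring.
  - now rewrite Hp, Hp'.
Qed.

Lemma even_periodic_sum (F : nat -> R -> R) (n : nat) :
  (forall k, (k <= n)%nat -> even_periodic (F k)) ->
  even_periodic (fun x => sum_f_R0 (fun k => F k x) n).
Proof.
  induction n as [|n IH]; intros H; [apply (H 0%nat); lia|].
  destruct IH as [Hc [Ho Hp]]; [intros k Hk; apply H; lia|].
  destruct (H (S n) (le_n _)) as [Hc' [Ho' Hp']].
  split; [|split]; intros x; simpl.
  - apply (continuous_plus (fun x => sum_f_R0 (fun k => F k x) n)); auto.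
  - rewrite Ho, Ho'; ring.
  - now rewrite Hp, Hp'.
Qed.

Lemma sin_odd_periodic : odd_periodic sin.
Proof.
  split; [|split]; intros x.
  - apply continuity_pt_filterlim, continuity_sin.
  - apply sin_neg.
  - rewrite sin_plus, sin_2PI, cos_2PI; ring.
Qed.

Lemma cos_even_periodic : even_periodic cos.
Proof.
  split; [|split]; intros x.
  - apply continuity_pt_filterlim, continuity_cos.
  - apply cos_neg.
  - rewrite cos_plus, sin_2PI, cos_2PI; ring.
Qed.

Lemma angle_coef_odd_periodic (s : nat -> R -> R) (n : nat) :
  (forall m, (m < n)%nat -> odd_periodic (s m)) -> odd_periodic (angle_coef s n).
Proof.
  intros H; destruct n as [|n].
  - apply (odd_periodic_ext (fun x => 0 * sin x)); [intros x; simpl; ring|].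
    apply odd_periodic_scal, sin_odd_periodic.
  - apply (odd_periodic_ext (fun x => (-1) * dprim (dprim (s n)) x)); [intros x; simpl; ring|].
    apply odd_periodic_scal, dprim_odd_periodic, dprim_odd_periodic, H; lia.
Qed.

(** Even times odd is odd and odd times odd is even, so the recursion preserves the parities of sine
    and cosine. Oddness keeps [dprim] inside the periodic functions: no solvability condition
    appears at any order. *)
Lemma trig_coef_parity (n : nat) : odd_periodic (sin_coef n) /\ even_periodic (cos_coef n).
Proof.
  induction n as [n IH] using lt_wf_ind; destruct n as [|n].
  - split; [exact sin_odd_periodic | exact cos_even_periodic].
  - assert (U : forall j, (j <= S n)%nat -> odd_periodic (angle_coef sin_coef j)).
    { intros j Hj; apply angle_coef_odd_periodic; intros m Hm; apply IH; lia. }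
    split.
    + apply (odd_periodic_ext (fun x => / INR (S n) * sum_f_R0 (fun k =>
        cos_coef k x * (INR (S (n - k)) * angle_coef sin_coef (S (n - k)) x)) n)).
      * intros x; rewrite sin_coef_S; unfold conv_coef, PS_mult, PS_derive, Rdiv; apply Rmult_comm.
      * apply odd_periodic_scal.
        apply (odd_periodic_sum (fun k x =>
          cos_coef k x * (INR (S (n - k)) * angle_coef sin_coef (S (n - k)) x))).
        intros k Hk; apply odd_periodic_mult; [apply IH; lia|].
        apply odd_periodic_scal, U; lia.
    + apply (even_periodic_ext (fun x => (- / INR (S n)) * sum_f_R0 (fun k =>
        sin_coef k x * (INR (S (n - k)) * angle_coef sin_coef (S (n - k)) x)) n)).
      * intros x; rewrite cos_coef_S; unfold conv_coef, PS_mult, PS_derive, Rdiv; ring.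
      * apply even_periodic_scal.
        apply (even_periodic_sum (fun k x =>
          sin_coef k x * (INR (S (n - k)) * angle_coef sin_coef (S (n - k)) x))).
        intros k Hk; apply even_periodic_mult; [apply IH; lia|].
        apply odd_periodic_scal, U; lia.
Qed.

(** * Majorants of the coefficients *)

(** The two [dprim] cost 1024 and the weighted convolution costs 8, together one more factor 8192.
    The factor n - k + 1 produced by differentiating in [mu] is at most n + 1 and is absorbed by the
    division by n + 1. *)
Lemma conv_coef_bound (s c : nat -> R -> R) (n : nat) (x : R) :
  (forall j, (j <= n)%nat -> odd_periodic (s j)) ->
  (forall j, (j <= n)%nat -> forall y, Rabs (s j y) <= 8192 ^ j / INR (S j) ^ 2) ->
  (forall j, (j <= n)%nat -> forall y, Rabs (c j y) <= 8192 ^ j / INR (S j) ^ 2) ->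
  Rabs (conv_coef s c n x) <= 8192 ^ S n / INR (S (S n)) ^ 2.
Proof.
  intros So Sb Cb; unfold conv_coef, PS_mult, PS_derive.
  assert (Hn : 1 <= INR (S n)) by (rewrite S_INR; pose proof (pos_INR n); lra).
  unfold Rdiv at 1; rewrite Rabs_mult, Rabs_inv, (Rabs_right (INR (S n))) by lra.
  apply (Rmult_le_reg_r (INR (S n))); [lra|].
  rewrite Rmult_assoc, Rinv_l, Rmult_1_r by lra.
  eapply Rle_trans; [apply sum_f_R0_triangle|].
  apply Rle_trans with (sum_f_R0 (fun k =>
     (/ (INR (S k)) ^ 2 * / (INR (S (n - k))) ^ 2) * (INR (S n) * (1024 * 8192 ^ n))) n).
  - apply sum_Rle; intros k Hk.
    rewrite !Rabs_mult, (Rabs_right (INR (S (n - k)))) by (apply Rle_ge, pos_INR).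
    simpl angle_coef; rewrite Rabs_Ropp.
    assert (HU : Rabs (dprim (dprim (s (n - k)%nat)) x)
                 <= 1024 * (8192 ^ (n - k) / INR (S (n - k)) ^ 2)).
    { replace (1024 * _) with (32 * (32 * (8192 ^ (n - k) / INR (S (n - k)) ^ 2))) by ring.
      apply dprim_bound; [apply dprim_odd_periodic, So; lia|].
      apply dprim_bound; [apply So; lia | apply Sb; lia]. }
    specialize (Cb k Hk x).
    assert (H1 : INR (S (n - k)) <= INR (S n)) by (apply le_INR; lia).
    apply Rle_trans with (8192 ^ k / INR (S k) ^ 2 *
      (INR (S n) * (1024 * (8192 ^ (n - k) / INR (S (n - k)) ^ 2)))).
    + apply Rmult_le_compat; try apply Rabs_pos; auto.
      * apply Rmult_le_pos; [apply pos_INR | apply Rabs_pos].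
      * apply Rmult_le_compat; auto; [apply pos_INR | apply Rabs_pos].
    + right; replace (8192 ^ n) with (8192 ^ k * 8192 ^ (n - k))
        by (rewrite <- pow_add; f_equal; lia).
      unfold Rdiv; ring.
  - rewrite <- scal_sum. pose proof (conv_inv_sq_le n) as H.
    replace (8192 ^ S n / INR (S (S n)) ^ 2 * INR (S n))
      with (INR (S n) * (1024 * 8192 ^ n) * (8 / INR (S (S n)) ^ 2))
      by (simpl pow at 3; unfold Rdiv; ring).
    apply Rmult_le_compat_l; [|exact H].
    apply Rmult_le_pos; [lra|].
    apply Rmult_le_pos; [lra | apply pow_le; lra].
Qed.

Lemma trig_coef_bound_sq (n : nat) (x : R) :
  Rabs (sin_coef n x) <= 8192 ^ n / INR (S n) ^ 2 /\
  Rabs (cos_coef n x) <= 8192 ^ n / INR (S n) ^ 2.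
Proof.
  revert x; induction n as [n IH] using lt_wf_ind; intros x; destruct n as [|n].
  - change (sin_coef 0) with sin; change (cos_coef 0) with cos; simpl.
    pose proof (SIN_bound x); pose proof (COS_bound x).
    split; apply Rabs_le; lra.
  - rewrite sin_coef_S, cos_coef_S, Rabs_Ropp.
    split; apply conv_coef_bound; intros j Hj; try apply trig_coef_parity;
      intros y; apply IH; lia.
Qed.

Lemma trig_coef_bound (n : nat) (x : R) :
  Rabs (sin_coef n x) <= 1 * 8192 ^ n /\ Rabs (cos_coef n x) <= 1 * 8192 ^ n.
Proof.
  assert (E : 8192 ^ n / INR (S n) ^ 2 <= 1 * 8192 ^ n).
  { assert (Hn : 1 <= INR (S n)) by (rewrite S_INR; pose proof (pos_INR n); lra).
    unfold Rdiv; rewrite (Rmult_comm (8192 ^ n)).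
    apply Rmult_le_compat_r; [apply pow_le; lra|].
    rewrite <- Rinv_1; apply Rinv_le_contravar; nra. }
  destruct (trig_coef_bound_sq n x); split; lra.
Qed.

(** * The universal periodic solution *)

Lemma open_Rabs_lt (r : R) : open (fun x => Rabs x < r).
Proof.
  apply (open_comp Rabs (fun x => x < r)); [|apply open_lt].
  intros x _; apply continuous_Rabs.
Qed.

Lemma diff_on_ext (n : nat) (D : R -> Prop) (f g : R -> R) :
  open D -> (forall x, D x -> f x = g x) -> diff_on n D f -> diff_on n D g.
Proof.
  intros HD E; destruct n as [|n]; [easy|].
  intros [f' [F1 F2]]; exists f'; split; [|exact F2].
  intros x Hx; apply (is_derive_ext_loc f); [|now apply F1].
  apply (filter_imp D); [exact E | now apply HD].
Qed.

Lemma ang_coef_bound (n : nat) (x : R) : Rabs (ang_coef n x) <= 1 * 8192 ^ n.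
Proof.
  destruct n as [|n]; [simpl; rewrite Rabs_R0; lra|].
  simpl; rewrite Rabs_Ropp, Rmult_1_l.
  apply Rle_trans with (32 * (32 * (1 * 8192 ^ n))).
  - apply dprim_bound; [apply dprim_odd_periodic, trig_coef_parity|].
    apply dprim_bound; [apply trig_coef_parity|]. intros y; apply trig_coef_bound.
  - assert (0 <= 8192 ^ n) by (apply pow_le; lra). lra.
Qed.

Definition sin_sum (mu x : R) : R := PSeries (fun n => sin_coef n x) mu.
Definition cos_sum (mu x : R) : R := PSeries (fun n => cos_coef n x) mu.

(* The odd 2 PI-periodic solution of [angle'''' = - mu * sin (x + angle)]. *)
Definition angle (mu x : R) : R := PSeries (fun n => ang_coef n x) mu.

Lemma in_radius_8192 (a : nat -> R) (B mu : R) :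
  (forall n, Rabs (a n) <= B * 8192 ^ n) -> Rabs mu * 8192 < 1 ->
  Rbar_lt (Rabs mu) (CV_radius a).
Proof. intros Ha Hmu; apply in_radius with 8192 B; auto; lra. Qed.

Lemma PS_derive_sin_coef (x : R) (n : nat) :
  PS_derive (fun n => sin_coef n x) n
  = PS_mult (fun n => cos_coef n x) (PS_derive (fun n => ang_coef n x)) n.
Proof.
  unfold PS_derive at 1; rewrite sin_coef_S; unfold conv_coef.
  change (INR (S n) * (PS_mult (fun j => cos_coef j x)
     (PS_derive (fun j => ang_coef j x)) n / INR (S n)) =
   PS_mult (fun n => cos_coef n x) (PS_derive (fun n => ang_coef n x)) n).
  field; apply not_0_INR; lia.
Qed.

Lemma PS_derive_cos_coef (x : R) (n : nat) :
  PS_derive (fun n => cos_coef n x) n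
  = PS_opp (PS_mult (fun n => sin_coef n x) (PS_derive (fun n => ang_coef n x))) n.
Proof.
  unfold PS_derive at 1; rewrite cos_coef_S; unfold conv_coef, PS_opp.
  change (INR (S n) * - (PS_mult (fun j => sin_coef j x)
     (PS_derive (fun j => ang_coef j x)) n / INR (S n)) =
   - PS_mult (fun n => sin_coef n x) (PS_derive (fun n => ang_coef n x)) n).
  field; apply not_0_INR; lia.
Qed.

(** For fixed x, both pairs solve S' = C u', C' = - S u' in [mu] and agree at [mu] = 0. The system
    is a rotation, so the squared distance [G] of the two solutions has zero derivative. *)
Lemma trig_sum_angle (mu x : R) : Rabs mu * 8192 < 1 ->
  sin_sum mu x = sin (x + angle mu x) /\ cos_sum mu x = cos (x + angle mu x).
Proof.
  intros Hmu.
  set (G := fun m => (sin_sum m x - sin (x + angle m x)) ^ 2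
                     + (cos_sum m x - cos (x + angle m x)) ^ 2).
  assert (D : forall m, Rabs m * 8192 < 1 -> is_derive G m 0).
  { intros m Hm.
    assert (Rs : Rbar_lt (Rabs m) (CV_radius (fun n => sin_coef n x)))
      by (apply in_radius_8192 with 1; auto; intros n; apply trig_coef_bound).
    assert (Rc : Rbar_lt (Rabs m) (CV_radius (fun n => cos_coef n x)))
      by (apply in_radius_8192 with 1; auto; intros n; apply trig_coef_bound).
    assert (Ru : Rbar_lt (Rabs m) (CV_radius (fun n => ang_coef n x)))
      by (apply in_radius_8192 with 1; auto; intros n; apply ang_coef_bound).
    assert (Ru' : Rbar_lt (Rabs m) (CV_radius (PS_derive (fun n => ang_coef n x))))
      by (now rewrite CV_radius_derive).
    pose proof (is_derive_PSeries _ _ Rs) as Ds.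
    pose proof (is_derive_PSeries _ _ Rc) as Dc.
    pose proof (is_derive_PSeries _ _ Ru) as Du.
    rewrite (PSeries_ext _ _ m (PS_derive_sin_coef x)), PSeries_mult in Ds by assumption.
    rewrite (PSeries_ext _ _ m (PS_derive_cos_coef x)), PSeries_opp, PSeries_mult in Dc
      by assumption.
    set (u' := PSeries (PS_derive (fun n => ang_coef n x)) m) in *.
    change (is_derive (fun m => sin_sum m x) m (cos_sum m x * u')) in Ds.
    change (is_derive (fun m => cos_sum m x) m (- (sin_sum m x * u'))) in Dc.
    change (is_derive (fun m => angle m x) m u') in Du.
    unfold G; evar_last.
    - apply (is_derive_plus (fun m => (sin_sum m x - sin (x + angle m x)) ^ 2)
               (fun m => (cos_sum m x - cos (x + angle m x)) ^ 2)).
      + apply (is_derive_pow (fun m => sin_sum m x - sin (x + angle m x)) 2).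
        apply (is_derive_minus (fun m => sin_sum m x)); [exact Ds|].
        apply (is_derive_comp sin (fun m => x + angle m x)).
        * apply is_derive_Reals, derivable_pt_lim_sin.
        * apply (is_derive_plus (fun _ => x) (fun m => angle m x));
            [apply (is_derive_const x) | exact Du].
      + apply (is_derive_pow (fun m => cos_sum m x - cos (x + angle m x)) 2).
        apply (is_derive_minus (fun m => cos_sum m x)); [exact Dc|].
        apply (is_derive_comp cos (fun m => x + angle m x)).
        * apply is_derive_Reals, derivable_pt_lim_cos.
        * apply (is_derive_plus (fun _ => x) (fun m => angle m x));
            [apply (is_derive_const x) | exact Du].
    - simpl; unfold plus, minus, scal, mult, opp, zero, plus; simpl; unfold mult; simpl. ring. }
  assert (G0 : G 0 = 0).
  { unfold G, sin_sum, cos_sum, angle; rewrite !PSeries_0.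
    change (sin_coef 0 x) with (sin x); change (cos_coef 0 x) with (cos x).
    change (ang_coef 0 x) with 0; rewrite Rplus_0_r; ring. }
  assert (Gm : G mu = 0).
  { rewrite <- G0; destruct (Rtotal_order mu 0) as [L|[->|L]]; [| reflexivity |].
    - apply (eq_is_derive G mu 0); [|exact L].
      intros t Ht; apply D; rewrite Rabs_left1 in Hmu |- *; lra.
    - symmetry; apply (eq_is_derive G 0 mu); [|exact L].
      intros t Ht; apply D; rewrite Rabs_right in Hmu |- *; lra. }
  unfold G in Gm.
  pose proof (pow2_ge_0 (sin_sum mu x - sin (x + angle mu x))).
  pose proof (pow2_ge_0 (cos_sum mu x - cos (x + angle mu x))).
  split; apply Rminus_diag_uniq; apply Rsqr_0_uniq; unfold Rsqr; lra.
Qed.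

(** The derivatives of [angle] in x, obtained by undoing the primitives in [angle_eq] one at a
    time. *)
Definition angle1 (mu x : R) : R := - mu * prim0 (dprim (sin_sum mu)) x.
Definition angle2 (mu x : R) : R := - mu * dprim (sin_sum mu) x.
Definition angle3 (mu x : R) : R := - mu * prim0 (sin_sum mu) x.

Section FixedParameter.

Variable mu : R.
Hypothesis Hmu : Rabs mu * 8192 < 1.

Lemma sin_sum_odd_periodic : odd_periodic (sin_sum mu).
Proof.
  apply (series_odd_periodic 8192 mu) with 1; try lra.
  - intros n; apply trig_coef_parity.
  - intros n x; apply trig_coef_bound.
Qed.

Lemma dprim_sin_sum (x : R) :
  dprim (sin_sum mu) x = PSeries (fun n => dprim (sin_coef n) x) mu.
Proof.
  apply (dprim_series 8192) with 1; try lra.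
  - intros n; apply trig_coef_parity.
  - intros n y; apply trig_coef_bound.
Qed.

Lemma dprim_coef_bound (n : nat) (x : R) :
  Rabs (dprim (sin_coef n) x) <= 32 * 8192 ^ n.
Proof.
  replace (32 * 8192 ^ n) with (32 * (1 * 8192 ^ n)) by ring.
  apply dprim_bound; [apply trig_coef_parity|]. intros y; apply trig_coef_bound.
Qed.

(** The fixed-point equation: the constant coefficient vanishes, a factor [mu] splits off, and
    [dprim] is applied term by term, twice. *)
Lemma angle_eq (x : R) : angle mu x = - mu * dprim (dprim (sin_sum mu)) x.
Proof.
  unfold angle; rewrite PSeries_decr_1_aux by reflexivity.
  rewrite (PSeries_ext _ (PS_opp (fun n => dprim (dprim (sin_coef n)) x)))
    by (intros n; reflexivity).
  rewrite PSeries_opp, (dprim_ext _ _ dprim_sin_sum).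
  rewrite (dprim_series 8192 mu) with (B := 32); try lra.
  - rewrite Ropp_mult_distr_r_reverse, Ropp_mult_distr_l_reverse; reflexivity.
  - intros n; apply dprim_odd_periodic, trig_coef_parity.
  - exact dprim_coef_bound.
Qed.

Lemma angle_odd_periodic : odd_periodic (angle mu).
Proof.
  apply (odd_periodic_ext (fun x => - mu * dprim (dprim (sin_sum mu)) x)).
  - intros x; now rewrite angle_eq.
  - apply odd_periodic_scal, dprim_odd_periodic, dprim_odd_periodic, sin_sum_odd_periodic.
Qed.

Lemma angle2_odd_periodic : odd_periodic (angle2 mu).
Proof. apply odd_periodic_scal, dprim_odd_periodic, sin_sum_odd_periodic. Qed.

Lemma angle_derive (x : R) : is_derive (angle mu) x (angle1 mu x).
Proof.
  apply (is_derive_ext (fun x => scal (- mu) (dprim (dprim (sin_sum mu)) x))).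
  - intros t; now rewrite angle_eq.
  - apply (is_derive_scal (dprim (dprim (sin_sum mu)))).
    apply prim_derive, prim0_continuous, dprim_odd_periodic, sin_sum_odd_periodic.
Qed.

Lemma angle1_derive (x : R) : is_derive (angle1 mu) x (angle2 mu x).
Proof.
  apply (is_derive_scal (prim0 (dprim (sin_sum mu)))).
  apply prim0_derive, dprim_odd_periodic, sin_sum_odd_periodic.
Qed.

Lemma angle2_derive (x : R) : is_derive (angle2 mu) x (angle3 mu x).
Proof.
  apply (is_derive_scal (dprim (sin_sum mu))).
  apply prim_derive, prim0_continuous, sin_sum_odd_periodic.
Qed.

Lemma angle3_derive (x : R) : is_derive (angle3 mu) x (- mu * sin (x + angle mu x)).
Proof.
  rewrite <- (proj1 (trig_sum_angle mu x Hmu)).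
  apply (is_derive_scal (prim0 (sin_sum mu))).
  apply prim0_derive, sin_sum_odd_periodic.
Qed.

Lemma sin_sum_bound (x : R) : Rabs (sin_sum mu x) <= 1.
Proof.
  rewrite (proj1 (trig_sum_angle mu x Hmu)).
  pose proof (SIN_bound (x + angle mu x)); apply Rabs_le; lra.
Qed.

Lemma angle_bound (x : R) : Rabs (angle mu x) <= 1.
Proof.
  rewrite angle_eq, Rabs_mult, Rabs_Ropp.
  assert (H : Rabs (dprim (dprim (sin_sum mu)) x) <= 32 * (32 * 1)).
  { apply dprim_bound; [apply dprim_odd_periodic, sin_sum_odd_periodic|].
    apply dprim_bound; [apply sin_sum_odd_periodic | exact sin_sum_bound]. }
  pose proof (Rabs_pos mu); nra.
Qed.

(** The purpose is 1 + [angle1] > 0, which makes the curvature of the waves positive; 256 / 8192 is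
    well below 1. *)
Lemma angle1_bound (x : R) : Rabs (angle1 mu x) < 1.
Proof.
  unfold angle1; rewrite Rabs_mult, Rabs_Ropp.
  assert (H : Rabs (prim0 (dprim (sin_sum mu)) x) <= 8 * (32 * 1)).
  { apply prim0_bound; [apply dprim_odd_periodic, sin_sum_odd_periodic|].
    apply dprim_bound; [apply sin_sum_odd_periodic | exact sin_sum_bound]. }
  pose proof (Rabs_pos mu); nra.
Qed.

(** At fixed x this exhibits a power series in [mu], from which smoothness in the parameter is read
    off. *)
Lemma angle1_series (x : R) :
  angle1 mu x = - mu * PSeries (fun n => prim0 (dprim (sin_coef n)) x) mu.
Proof.
  unfold angle1; rewrite (prim0_ext _ _ dprim_sin_sum).
  rewrite (prim0_series 8192 mu) with (B := 32); auto; try lra.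
  - intros n; apply dprim_odd_periodic, trig_coef_parity.
  - exact dprim_coef_bound.
Qed.

Lemma angle3_series (x : R) :
  angle3 mu x = - mu * PSeries (fun n => prim0 (sin_coef n) x) mu.
Proof.
  unfold angle3; f_equal.
  apply (prim0_series 8192 mu) with (B := 1); auto; try lra.
  - intros n; apply trig_coef_parity.
  - intros n y; apply trig_coef_bound.
Qed.

Lemma prim_cos_series (x : R) :
  prim (fun y => cos (y + angle mu y)) x = PSeries (fun n => prim (cos_coef n) x) mu.
Proof.
  rewrite <- (prim_series 8192 mu) with (B := 1); try lra.
  - apply prim_ext; intros y; now rewrite <- (proj2 (trig_sum_angle mu y Hmu)).
  - intros n y; apply trig_coef_parity.
  - intros n y; apply trig_coef_bound.
Qed.

End FixedParameter.

(** * Dependence on the parameter *)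

Definition small (mu : R) : Prop := Rabs mu < / 8192.

Lemma small_lt1 (mu : R) : small mu -> Rabs mu * 8192 < 1.
Proof. unfold small; lra. Qed.

Lemma diff_on_neg_mult_PSeries (n : nat) (a : nat -> R) (B : R) (f : R -> R) :
  (forall k, Rabs (a k) <= B * 8192 ^ k) ->
  (forall mu, Rabs mu * 8192 < 1 -> f mu = - mu * PSeries a mu) -> diff_on n small f.
Proof.
  intros Ha E; apply diff_on_ext with (fun mu => ((-1) * mu) * PSeries a mu).
  - apply open_Rabs_lt.
  - intros mu Hmu; rewrite E by now apply small_lt1. ring.
  - apply diff_on_mult; [apply diff_on_mult; [apply diff_on_const | apply diff_on_id]|].
    apply diff_on_PSeries, CV_radius_ge with B 8192; auto; lra.
Qed.

Lemma prim0_dprim_coef_bound (n : nat) (x : R) :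
  Rabs (prim0 (dprim (sin_coef n)) x) <= 256 * 8192 ^ n.
Proof.
  replace (256 * 8192 ^ n) with (8 * (32 * 8192 ^ n)) by ring.
  apply prim0_bound; [apply dprim_odd_periodic, trig_coef_parity|].
  intros y; apply dprim_coef_bound.
Qed.

Lemma prim0_coef_bound (n : nat) (x : R) :
  Rabs (prim0 (sin_coef n) x) <= 8 * 8192 ^ n.
Proof.
  replace (8 * 8192 ^ n) with (8 * (1 * 8192 ^ n)) by ring.
  apply prim0_bound; [apply trig_coef_parity|]. intros y; apply trig_coef_bound.
Qed.

Lemma prim_cos_coef_bound (n : nat) :
  Rabs (prim (cos_coef n) PI) <= 4 * 8192 ^ n.
Proof.
  replace (4 * 8192 ^ n) with (4 * (1 * 8192 ^ n)) by ring.
  apply prim_bound; [apply trig_coef_parity | intros y; apply trig_coef_bound|].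
  pose proof PI_4; pose proof PI_RGT_0; apply Rabs_le; lra.
Qed.

Lemma angle1_diff_on (n : nat) (x : R) : diff_on n small (fun mu => angle1 mu x).
Proof.
  apply diff_on_neg_mult_PSeries with (fun n => prim0 (dprim (sin_coef n)) x) 256.
  - intros k; apply prim0_dprim_coef_bound.
  - intros mu Hmu; exact (angle1_series mu Hmu x).
Qed.

Lemma angle3_diff_on (n : nat) (x : R) : diff_on n small (fun mu => angle3 mu x).
Proof.
  apply diff_on_neg_mult_PSeries with (fun n => prim0 (sin_coef n) x) 8.
  - intros k; apply prim0_coef_bound.
  - intros mu Hmu; exact (angle3_series mu Hmu x).
Qed.

(** * Explicit coefficients of low order *)

Lemma prim0_sin (x : R) : prim0 sin x = - cos x.
Proof.
  apply (prim0_unique sin (fun x => - cos x)).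
  - apply sin_odd_periodic.
  - intros y; auto_derive; [trivial | ring].
  - rewrite (prim_unique _ (fun x => - sin x)).
    + rewrite sin_PI, sin_0; ring.
    + intros y; apply (continuous_opp cos), cos_even_periodic.
    + intros y; auto_derive; [trivial | ring].
Qed.

Lemma dprim_sin (x : R) : dprim sin x = - sin x.
Proof.
  unfold dprim; rewrite (prim_unique _ (fun x => - sin x)).
  - rewrite sin_0; ring.
  - apply prim0_continuous, sin_odd_periodic.
  - intros y; rewrite prim0_sin; auto_derive; [trivial | ring].
Qed.

Lemma prim0_dprim_sin (x : R) : prim0 (dprim sin) x = cos x.
Proof.
  apply (prim0_unique (dprim sin) cos).
  - apply dprim_odd_periodic, sin_odd_periodic.
  - intros y; rewrite dprim_sin; auto_derive; [trivial | ring].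
  - rewrite (prim_unique _ sin).
    + rewrite sin_PI, sin_0; ring.
    + apply cos_even_periodic.
    + intros y; auto_derive; [trivial | ring].
Qed.

(** Sine is a fixed point of the inverted fourth derivative, so to first order [angle] is - mu sin
    x. *)
Lemma dprim_dprim_sin (x : R) : dprim (dprim sin) x = sin x.
Proof.
  change (dprim (dprim sin) x) with (prim (prim0 (dprim sin)) x).
  rewrite (prim_unique _ sin).
  - rewrite sin_0; ring.
  - apply prim0_continuous, dprim_odd_periodic, sin_odd_periodic.
  - intros y; rewrite prim0_dprim_sin; auto_derive; [trivial | ring].
Qed.

Lemma sin_coef_1 (x : R) : sin_coef 1 x = - (cos x * sin x).
Proof.
  rewrite sin_coef_S.
  change (cos x * (INR 1 * - dprim (dprim sin) x) / INR 1 = - (cos x * sin x)).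
  rewrite dprim_dprim_sin; simpl; field.
Qed.

Lemma cos_coef_1 (x : R) : cos_coef 1 x = sin x * sin x.
Proof.
  rewrite cos_coef_S.
  change (- (sin x * (INR 1 * - dprim (dprim sin) x) / INR 1) = sin x * sin x).
  rewrite dprim_dprim_sin; simpl; field.
Qed.

(** The constant - 1 / 4 removes the mean of cos^2 / 2 over a half period. *)
Lemma prim0_sin_coef_1 (x : R) : prim0 (sin_coef 1) x = cos x * cos x / 2 - / 4.
Proof.
  apply (prim0_unique (sin_coef 1) (fun x => cos x * cos x / 2 - / 4)).
  - apply trig_coef_parity.
  - intros y; rewrite sin_coef_1; auto_derive; [trivial | field].
  - rewrite (prim_unique _ (fun x => sin x * cos x / 4)).
    + rewrite sin_PI, sin_0; field.
    + intros y; apply (ex_derive_continuous (fun x => cos x * cos x / 2 - / 4)); auto_derive; trivial.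
    + intros y; auto_derive; [trivial|].
      pose proof (sin2_cos2 y) as H; unfold Rsqr in H; nra.
Qed.

Lemma prim_cos_coef_1 : prim (cos_coef 1) PI = PI / 2.
Proof.
  rewrite (prim_unique _ (fun x => x / 2 - sin x * cos x / 2)).
  - rewrite sin_PI, sin_0; field.
  - apply trig_coef_parity.
  - intros y; rewrite cos_coef_1; auto_derive; [trivial|].
    pose proof (sin2_cos2 y) as H; unfold Rsqr in H; nra.
Qed.

Lemma PSeries_continuous_0 (a : nat -> R) (B : R) :
  (forall k, Rabs (a k) <= B * 8192 ^ k) -> continuous (PSeries a) 0.
Proof.
  intros Ha; apply continuity_pt_filterlim, PSeries_continuity.
  apply in_radius_8192 with B; auto. rewrite Rabs_R0; lra.
Qed.

Lemma decr_bound (a : nat -> R) (B : R) :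
  (forall k, Rabs (a k) <= B * 8192 ^ k) ->
  forall k, Rabs (PS_decr_1 a k) <= (B * 8192) * 8192 ^ k.
Proof. intros Ha k; unfold PS_decr_1; specialize (Ha (S k)); simpl in Ha; lra. Qed.

(** This is (c - a b) / A^4 for c = A^4 mu, a = A (1 + [angle1 mu 0]) and b = A^3 [angle3 mu 0],
    that is, lambda / A^4. *)
Definition stretch (mu : R) : R := mu - (1 + angle1 mu 0) * angle3 mu 0.

(* To second order [stretch mu = 5/4 mu^2], and to first order the integral is [PI/2 mu]. *)
Lemma stretch_pos_near_0 : exists m, 0 < m <= / 8192 /\
  forall mu, 0 < Rabs mu < m ->
    0 < stretch mu /\ prim (fun x => cos (x + angle mu x)) PI <> 0.
Proof.
  set (a := fun n => prim0 (dprim (sin_coef n)) 0).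
  set (b := fun n => prim0 (sin_coef n) 0).
  set (d := fun n => prim (cos_coef n) PI).
  assert (Ba : forall k, Rabs (a k) <= 256 * 8192 ^ k)
    by (intros k; exact (prim0_dprim_coef_bound k 0)).
  assert (Bb : forall k, Rabs (b k) <= 8 * 8192 ^ k)
    by (intros k; exact (prim0_coef_bound k 0)).
  assert (Bd : forall k, Rabs (d k) <= 4 * 8192 ^ k)
    by (intros k; exact (prim_cos_coef_bound k)).
  (* [stretch mu] equals mu^2 [w mu]: its linear terms cancel because [b 0] = - 1. At 0 the value is
     1 / 4 + 1 = 5 / 4. *)
  set (w := fun mu => PSeries (PS_decr_1 b) mu - PSeries a mu * PSeries b mu).
  assert (Cw : continuous w 0).
  { apply (continuous_minus (PSeries (PS_decr_1 b)) (fun mu => PSeries a mu * PSeries b mu)).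
    - eapply PSeries_continuous_0, decr_bound, Bb.
    - apply (continuous_mult (PSeries a) (PSeries b)); eapply PSeries_continuous_0; eauto. }
  assert (Cd : continuous (PSeries (PS_decr_1 d)) 0)
    by (eapply PSeries_continuous_0, decr_bound, Bd).
  assert (W0 : 0 < w 0).
  { unfold w; rewrite !PSeries_0; unfold PS_decr_1, a, b.
    rewrite prim0_sin_coef_1. change (sin_coef 0) with sin.
    rewrite prim0_sin, prim0_dprim_sin, cos_0; lra. }
  assert (D0 : 0 < PSeries (PS_decr_1 d) 0).
  { rewrite PSeries_0; unfold PS_decr_1, d; rewrite prim_cos_coef_1.
    pose proof PI_RGT_0; lra. }
  assert (Lw : locally 0 (fun mu => 0 < w mu)) by (apply (Cw (fun y => 0 < y)), open_gt, W0).
  assert (Ld : locally 0 (fun mu => 0 < PSeries (PS_decr_1 d) mu))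
    by (apply (Cd (fun y => 0 < y)), open_gt, D0).
  destruct (filter_and _ _ Lw Ld) as [r Hr].
  exists (Rmin r (/ 8192)); split.
  - split; [apply Rmin_pos; [apply cond_pos | lra] | apply Rmin_r].
  - intros mu [M0 M1].
    assert (Hmu : Rabs mu * 8192 < 1).
    { pose proof (Rmin_r r (/ 8192)); lra. }
    destruct (Hr mu) as [Hw Hd].
    { change (Rabs (mu - 0) < r); rewrite Rminus_0_r.
      eapply Rlt_le_trans; [exact M1 | apply Rmin_l]. }
    assert (M2 : 0 < mu * mu) by (unfold Rabs in M0; destruct (Rcase_abs mu); nra).
    split.
    + unfold stretch; rewrite angle1_series, angle3_series by assumption.
      change (0 < mu - (1 + - mu * PSeries a mu) * (- mu * PSeries b mu)).
      assert (Eb : PSeries b mu = b 0%nat + mu * PSeries (PS_decr_1 b) mu).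
      { apply PSeries_decr_1, CV_radius_inside, (in_radius_8192 b 8); auto. }
      assert (b0 : b 0%nat = -1).
      { unfold b; change (sin_coef 0) with sin; rewrite prim0_sin, cos_0; ring. }
      replace (mu - (1 + - mu * PSeries a mu) * (- mu * PSeries b mu))
        with (mu * (1 + PSeries b mu) - (mu * mu) * (PSeries a mu * PSeries b mu)) by ring.
      rewrite Eb at 1; rewrite b0.
      replace (mu * (1 + (-1 + mu * PSeries (PS_decr_1 b) mu)) - mu * mu * (PSeries a mu * PSeries b mu))
        with (mu * mu * w mu) by (unfold w; ring).
      now apply Rmult_lt_0_compat.
    + rewrite prim_cos_series by assumption.
      change (PSeries d mu <> 0).
      (* The constant coefficient is the integral of cosine over a half period, which vanishes; the
         factor [mu] splits off and leaves a series with value PI / 2 at 0. *)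
      rewrite PSeries_decr_1_aux.
      * apply Rmult_integral_contrapositive_currified; [|apply Rgt_not_eq, Hd].
        intros ->; lra.
      * unfold d; change (cos_coef 0) with cos.
        rewrite (prim_unique cos sin), sin_PI, sin_0; [ring | apply cos_even_periodic |].
        intros y; auto_derive; [trivial | ring].
Qed.

(** The leading coefficient is [prim0 sin PI] = 1, preceded by - mu. The sign is reversed to obtain
    a positive derivative, as [local_inverse] expects. *)
Lemma angle3_PI_derive_0 :
  angle3 0 PI = 0 /\ is_derive (fun mu => - angle3 mu PI) 0 1.
Proof.
  split; [unfold angle3; ring|].
  set (e := fun n => prim0 (sin_coef n) PI).
  assert (Re : Rbar_lt (Rabs 0) (CV_radius e)).
  { apply in_radius_8192 with 8; [intros k; exact (prim0_coef_bound k PI) | rewrite Rabs_R0; lra]. }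
  apply is_derive_ext_loc with (fun mu => mu * PSeries e mu).
  - assert (H : locally 0 (fun mu => Rabs mu < / 8192)).
    { apply (open_Rabs_lt (/ 8192)). rewrite Rabs_R0; lra. }
    revert H; apply filter_imp; intros mu Hmu.
    rewrite angle3_series by lra. change (mu * PSeries e mu = - (- mu * PSeries e mu)); ring.
  - replace 1 with (plus (mult 1 (PSeries e 0)) (mult 0 (PSeries (PS_derive e) 0))).
    + apply (is_derive_mult (fun mu => mu) (PSeries e)).
      * apply (is_derive_id 0).
      * now apply is_derive_PSeries.
      * intros; apply Rmult_comm.
    + rewrite !PSeries_0.
      change (1 * prim0 sin PI + 0 * PS_derive e 0 = 1).
      rewrite prim0_sin, cos_PI; ring.
Qed.

(** * The scalar inverse function theorem *)

(** Where f' > d / 2, the mean value theorem makes f expand distances by at least d / 2. This yields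
    the range needed for the intermediate value theorem, injectivity, and continuity of the inverse;
    its smoothness follows by bootstrapping g' = 1 / f'(g). *)
Lemma local_inverse (f : R -> R) (m d : R) :
  0 < m -> f 0 = 0 -> 0 < d -> is_derive f 0 d ->
  (forall n, diff_on n (fun x => Rabs x < m) f) ->
  exists (r : R) (g : R -> R), 0 < r /\ g 0 = 0 /\
    (forall y, Rabs y < r -> Rabs (g y) < m /\ f (g y) = y) /\
    (forall n, diff_on n (fun y => Rabs y < r) g).
Proof.
  intros Hm f0 Hd Df Sf.
  (* The second derivative is used only for the continuity of f'. *)
  destruct (Sf 2%nat) as [f' [F1 [f'' [F2 _]]]].
  assert (m0 : Rabs 0 < m) by (rewrite Rabs_R0; lra).
  assert (E0 : f' 0 = d).
  { transitivity (Derive f 0); [symmetry|]; apply is_derive_unique; auto. }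
  assert (C0 : continuous f' 0) by (eapply is_derive_continuous; auto).
  assert (Hc : locally 0 (fun x => d / 2 < f' x)).
  { apply (C0 (fun y => d / 2 < y)), (open_gt (d / 2)); lra. }
  destruct Hc as [rho0 Hc].
  set (rho := Rmin (rho0 / 2) (m / 2)).
  assert (Hrho : 0 < rho /\ rho < rho0 /\ rho < m).
  { pose proof (cond_pos rho0). pose proof (Rmin_l (rho0 / 2) (m / 2)).
    pose proof (Rmin_r (rho0 / 2) (m / 2)).
    split; [apply Rmin_pos; lra | unfold rho; lra]. }
  assert (Hf' : forall x, Rabs x <= rho -> d / 2 < f' x /\ Rabs x < m).
  { intros x Hx; split; [|lra]. apply Hc.
    change (Rabs (x - 0) < rho0); rewrite Rminus_0_r; lra. }
  assert (MV : forall x y, Rabs x <= rho -> Rabs y <= rho -> exists z,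
             Rabs z <= rho /\ Rmin x y <= z <= Rmax x y /\ f y - f x = f' z * (y - x)).
  { intros x y Hx Hy.
    assert (B : forall z, Rmin x y <= z <= Rmax x y -> Rabs z <= rho).
    { intros z Hz; apply Rabs_le_between in Hx; apply Rabs_le_between in Hy; apply Rabs_le.
      unfold Rmin, Rmax in Hz; destruct (Rle_dec x y); lra. }
    destruct (MVT_gen f x y f') as [z [Hz E]].
    - intros z Hz; apply F1, Hf', B; lra.
    - intros z Hz; apply continuity_pt_filterlim; eapply is_derive_continuous.
      apply F1, Hf', B; lra.
    - exists z; auto. }
  (* By the expansion, f(rho) >= r and f(- rho) <= - r, so all values below r in modulus are
     attained. *)
  set (r := d / 2 * rho).
  assert (Hr : 0 < r) by (apply Rmult_lt_0_compat; lra).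
  assert (Low : forall x y, Rabs x <= rho -> Rabs y <= rho ->
             d / 2 * Rabs (y - x) <= Rabs (f y - f x)).
  { intros x y Hx Hy; destruct (MV x y Hx Hy) as [z [Hz [_ E]]].
    rewrite E, Rabs_mult; apply Rmult_le_compat_r; [apply Rabs_pos|].
    destruct (Hf' z Hz); rewrite Rabs_right; lra. }
  (* The condition on y sits inside the existential so that choice gives a total function; outside
     the range any value, here 0, will do. *)
  assert (Ex : forall y, exists x, Rabs y < r -> Rabs x <= rho /\ f x = y).
  { intros y; destruct (Rlt_dec (Rabs y) r) as [Hy|Hy]; [|exists 0; intros; lra].
    apply Rabs_def2 in Hy.
    assert (Rr : Rabs rho <= rho) by (rewrite Rabs_right; lra).
    assert (Rl : Rabs (- rho) <= rho) by (rewrite Rabs_Ropp; exact Rr).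
    assert (Rz : Rabs 0 <= rho) by (rewrite Rabs_R0; lra).
    destruct (MV 0 rho Rz Rr) as [z1 [Z1 [_ E1]]].
    destruct (MV (- rho) 0 Rl Rz) as [z2 [Z2 [_ E2]]].
    destruct (Hf' z1 Z1) as [P1 _]; destruct (Hf' z2 Z2) as [P2 _].
    destruct (Ranalysis5.IVT_interv (fun x => f x - y) (- rho) rho) as [x [Hx Hfx]].
    - intros x Hx; apply continuity_pt_filterlim, (continuous_minus f (fun _ => y));
        [|apply continuous_const].
      eapply is_derive_continuous; apply F1, Hf'; apply Rabs_le; lra.
    - lra.
    - unfold r in *; nra.
    - unfold r in *; nra.
    - exists x; intros _; split; [apply Rabs_le; lra | lra]. }
  destruct (functional_choice _ Ex) as [g Hg].
  assert (g0 : g 0 = 0).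
  { destruct (Hg 0) as [G1 G2]; [rewrite Rabs_R0; lra|].
    pose proof (Low 0 (g 0)) as L. rewrite G2, f0, !Rminus_0_r, Rabs_R0 in L.
    specialize (L ltac:(lra) G1).
    apply Rabs_eq_0. pose proof (Rabs_pos (g 0)). nra. }
  (* The difference quotient of g is exactly 1 / f'(z) with z between g(y) and g(y + h), and the
     expansion bound [Low] forces z to g(y) as h tends to 0. *)
  assert (Dg : forall y, Rabs y < r -> is_derive g y (/ f' (g y))).
  { intros y Hy; destruct (Hg y Hy) as [G1 G2].
    destruct (Hf' _ G1) as [P1 P2].
    apply is_derive_Reals; intros eps Heps.
    assert (Ci : continuous (fun x => / f' x) (g y)).
    { apply continuity_pt_filterlim, (continuity_pt_inv f'); [|lra].
      apply continuity_pt_filterlim; eapply is_derive_continuous; apply F2, P2. }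
    destruct (proj1 (filterlim_locally _ _) Ci (mkposreal eps Heps)) as [del Hdel].
    destruct (open_Rabs_lt r y Hy) as [del2 Hdel2].
    assert (HD : 0 < Rmin (d / 2 * del) del2).
    { apply Rmin_pos; [apply Rmult_lt_0_compat; [lra | apply cond_pos] | apply cond_pos]. }
    exists (mkposreal _ HD); intros h Hh0 Hh; simpl in Hh.
    assert (Hyh : Rabs (y + h) < r).
    { apply Hdel2. change (Rabs (y + h - y) < del2).
      replace (y + h - y) with h by ring. eapply Rlt_le_trans; [exact Hh | apply Rmin_r]. }
    destruct (Hg (y + h) Hyh) as [K1 K2].
    pose proof (Low (g y) (g (y + h)) G1 K1) as L.
    destruct (MV (g y) (g (y + h)) G1 K1) as [z [Z1 [Z2 E]]].
    destruct (Hf' z Z1) as [Pz _].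
    rewrite K2, G2 in E, L. replace (y + h - y) with h in E, L by ring.
    replace ((g (y + h) - g y) / h) with (/ f' z).
    2:{ clear - E Pz Hd Hh0. revert E; generalize (g (y + h) - g y); intros k ->.
        field; split; [|lra]. intros ->; apply Hh0; ring. }
    apply Hdel. change (Rabs (z - g y) < del).
    assert (Rabs (z - g y) <= Rabs (g (y + h) - g y)).
    { unfold Rmin, Rmax in Z2; destruct (Rle_dec (g y) (g (y + h)));
        [rewrite !Rabs_right by lra | rewrite !Rabs_left1 by lra]; lra. }
    assert (Rabs h < d / 2 * del) by (eapply Rlt_le_trans; [exact Hh | apply Rmin_l]).
    nra. }
  exists r, g; split; [exact Hr|]; split; [exact g0|]; split.
  - intros y Hy; destruct (Hg y Hy) as [G1 G2]; split; [|exact G2]. apply (Hf' _ G1).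
  - induction n as [|n IH]; [exact I|].
    (* If g has n derivatives, so has 1 / f'(g); hence g has n + 1. *)
    exists (fun y => / f' (g y)); split; [exact Dg|].
    apply diff_on_inv.
    + intros y Hy; destruct (Hg y Hy) as [G1 _]; destruct (Hf' _ G1); lra.
    + apply (diff_on_comp n _ (fun x => Rabs x < m)); [| |exact IH].
      * intros y Hy; destruct (Hg y Hy) as [G1 _]; now apply Hf'.
      (* The derivative supplied at this order is a new witness; uniqueness of derivatives
         identifies it with f' on the interval. *)
      * destruct (Sf (S n)) as [f1 [H1 H2]].
        apply (diff_on_ext n _ f1); [apply open_Rabs_lt | | exact H2].
        intros x Hx; transitivity (Derive f x); [symmetry|]; apply is_derive_unique; auto.
Qed.

(** * Uniqueness of the arc *)

(** [filterdiff] speaks of every limit point of the filter. As x lies in D, separation of points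
    shows that x is the only one. *)
Lemma is_derive_is_derive_within (D : R -> Prop) (f : R -> R) (x l : R) :
  D x -> is_derive f x l -> is_derive_within D f x l.
Proof.
  intros Dx [Hl H]; split; [exact Hl|].
  intros y Hy eps.
  assert (y = x) as ->.
  { destruct (Req_dec y x) as [E|N]; [exact E|exfalso].
    assert (Hd : 0 < Rabs (x - y)) by (apply Rabs_pos_lt; lra).
    assert (L : locally y (fun z => Rabs (z - y) < Rabs (x - y))).
    { exists (mkposreal _ Hd); intros z Hz; exact Hz. }
    specialize (Hy _ L); apply locally_singleton in Hy; specialize (Hy Dx); lra. }
  apply filter_le_within, (H x); now intros P.
Qed.

Lemma is_derive_within_bound (D : R -> Prop) (f : R -> R) (x l eps : R) :
  0 < eps -> is_derive_within D f x l ->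
  exists del, 0 < del /\ forall y, D y -> Rabs (y - x) < del ->
    Rabs (f y - f x - (y - x) * l) <= eps * Rabs (y - x).
Proof.
  intros He [_ H].
  destruct (H x (@filter_le_within _ (locally x) _ D) (mkposreal eps He)) as [del Hdel].
  exists del; split; [apply cond_pos|]. intros y Dy Hy; apply (Hdel y Hy Dy).
Qed.

Lemma is_derive_within_interior (D : R -> Prop) (f : R -> R) (x l : R) :
  locally x D -> is_derive_within D f x l -> is_derive f x l.
Proof.
  intros HD Hf; split; [apply is_linear_scal_l|].
  intros y Hy; rewrite <- (is_filter_lim_locally_unique _ _ Hy); intros eps.
  destruct (is_derive_within_bound D f x l eps (cond_pos eps) Hf) as [del [Hdel B]].
  generalize (filter_and _ _ HD (locally_ball x (mkposreal del Hdel))).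
  apply filter_imp; intros z [Dz Hz]; exact (B z Dz Hz).
Qed.

(** Composition with this retraction onto the interval turns functions with one-sided derivatives at
    the ends into continuous functions on the line, to which the mean value theorem applies. *)
Definition clamp (l s : R) : R := Rmax 0 (Rmin l s).

Lemma clamp_in (l s : R) : 0 <= l -> 0 <= clamp l s <= l.
Proof.
  intros Hl; unfold clamp, Rmax, Rmin.
  destruct (Rle_dec l s); [destruct (Rle_dec 0 l) | destruct (Rle_dec 0 s)]; lra.
Qed.

Lemma clamp_id (l s : R) : 0 <= s <= l -> clamp l s = s.
Proof.
  intros Hs; unfold clamp; rewrite Rmin_right, Rmax_right; lra.
Qed.

Lemma clamp_lipschitz (l s t : R) : Rabs (clamp l t - clamp l s) <= Rabs (t - s).
Proof.
  unfold clamp, Rmax, Rmin.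
  destruct (Rle_dec l s), (Rle_dec l t); repeat destruct (Rle_dec 0 _);
    unfold Rabs; repeat destruct (Rcase_abs _); lra.
Qed.

Section Clamped.

Variable l : R.
Hypothesis Hl : 0 <= l.
Let D (t : R) : Prop := 0 <= t <= l.

Lemma clamped_continuous (f f' : R -> R) :
  (forall s, D s -> is_derive_within D f s (f' s)) ->
  forall s, continuous (fun t => f (clamp l t)) s.
Proof.
  intros Hf s; apply filterlim_locally; intros eps.
  (* Tolerance 1 suffices: near the point, increments of f are bounded by 1 + |d| times the
     distance. *)
  destruct (is_derive_within_bound D f _ _ 1 Rlt_0_1 (Hf _ (clamp_in l s Hl)))
    as [del [Hdel B]].
  set (d := f' (clamp l s)) in *.
  assert (Hm : 0 < 1 + Rabs d) by (pose proof (Rabs_pos d); lra).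
  assert (HD : 0 < Rmin del (eps / (1 + Rabs d))).
  { apply Rmin_pos; [exact Hdel|]. apply Rdiv_lt_0_compat; [apply cond_pos | exact Hm]. }
  exists (mkposreal _ HD); intros t Ht.
  change (Rabs (t - s) < Rmin del (eps / (1 + Rabs d))) in Ht.
  change (Rabs (f (clamp l t) - f (clamp l s)) < eps).
  pose proof (clamp_lipschitz l s t) as HL.
  pose proof (Rmin_l del (eps / (1 + Rabs d))). pose proof (Rmin_r del (eps / (1 + Rabs d))).
  specialize (B (clamp l t) (clamp_in l t Hl) ltac:(lra)).
  set (y := clamp l t - clamp l s) in *.
  replace (f (clamp l t) - f (clamp l s))
    with (f (clamp l t) - f (clamp l s) - y * d + y * d) by ring.
  eapply Rle_lt_trans; [apply Rabs_triang|]. rewrite Rabs_mult.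
  apply Rle_lt_trans with ((1 + Rabs d) * Rabs (t - s)).
  - pose proof (Rabs_pos d); nra.
  - rewrite Rmult_comm; apply Rlt_div_r; lra.
Qed.

Lemma clamped_derive (f : R -> R) (s d : R) :
  0 < s < l -> is_derive_within D f s d -> is_derive (fun t => f (clamp l t)) s d.
Proof.
  intros Hs Hf.
  assert (L : locally s (fun t => 0 < t < l)).
  { apply (open_and (fun t => 0 < t) (fun t => t < l)); [apply open_gt | apply open_lt | exact Hs]. }
  apply (is_derive_ext_loc f).
  - revert L; apply filter_imp; intros t Ht; rewrite clamp_id; lra.
  - apply (is_derive_within_interior D); [|exact Hf].
    revert L; apply filter_imp; intros t Ht; unfold D; lra.
Qed.

End Clamped.

Lemma cos_lipschitz (x y : R) : Rabs (cos y - cos x) <= Rabs (y - x).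
Proof.
  rewrite <- (Rmult_1_l (Rabs (y - x))).
  apply (Rabs_sub_le_of_derive cos (fun z => - sin z)).
  - intros z; auto_derive; [trivial | ring].
  - intros z; rewrite Rabs_Ropp; pose proof (SIN_bound z); apply Rabs_le; lra.
Qed.

(* Gronwall: the squared distance [E] of two solutions has [E' <= (2 + |c|) E] and [E 0 = 0]. *)
Lemma arc_solution_unique (l a b lam : R) (k p q th k' p' q' th' : R -> R) :
  0 < l -> arc_solution l a b lam k p q th -> arc_solution l a b lam k' p' q' th' ->
  forall s, 0 <= s <= l -> k' s = k s /\ p' s = p s /\ q' s = q s /\ th' s = th s.
Proof.
  intros Hl [Ak Ap Aq At k0 p0 q0 t0] [Bk Bp Bq Bt k0' p0' q0' t0'] s Hs.
  set (c := a * b + lam) in *; set (M := 2 + Rabs c).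
  set (cl := clamp l).
  set (E := fun t => (k' (cl t) - k (cl t)) ^ 2 + (p' (cl t) - p (cl t)) ^ 2
                   + (q' (cl t) - q (cl t)) ^ 2 + (th' (cl t) - th (cl t)) ^ 2).
  set (dE := fun t =>
     2 * (k' (cl t) - k (cl t)) * (p' (cl t) - p (cl t))
   + 2 * (p' (cl t) - p (cl t)) * (q' (cl t) - q (cl t))
   + 2 * (q' (cl t) - q (cl t)) * (c * (cos (th' (cl t)) - cos (th (cl t))))
   + 2 * (th' (cl t) - th (cl t)) * (k' (cl t) - k (cl t))).
  assert (Hle : forall t, dE t <= M * E t).
  { intros t; unfold dE, E, M.
    pose proof (cos_lipschitz (th (cl t)) (th' (cl t))) as HL.
    set (u := k' (cl t) - k (cl t)); set (v := p' (cl t) - p (cl t)).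
    set (w := q' (cl t) - q (cl t)); set (z := th' (cl t) - th (cl t)) in *.
    set (g := cos (th' (cl t)) - cos (th (cl t))) in *.
    (* Cosine is 1-Lipschitz, so |g| <= |z|, and 2 |w| |z| <= w^2 + z^2. *)
    assert (H1 : 2 * w * (c * g) <= Rabs c * (w ^ 2 + z ^ 2)).
    { apply Rle_trans with (Rabs c * (2 * (Rabs w * Rabs g))).
      - eapply Rle_trans; [apply Rle_abs|]. rewrite !Rabs_mult, (Rabs_right 2) by lra.
        right; ring.
      - apply Rmult_le_compat_l; [apply Rabs_pos|].
        rewrite <- (pow2_abs w), <- (pow2_abs z).
        pose proof (Rabs_pos w); pose proof (Rabs_pos g); pose proof (Rabs_pos z).
        pose proof (pow2_ge_0 (Rabs w - Rabs z)); nra. }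
    pose proof (pow2_ge_0 (u - v)); pose proof (pow2_ge_0 (v - w)); pose proof (pow2_ge_0 (z - u)).
    pose proof (pow2_ge_0 u); pose proof (pow2_ge_0 v); pose proof (pow2_ge_0 w).
    pose proof (pow2_ge_0 z); pose proof (Rabs_pos c); nra. }
  assert (DF : forall f f' g g',
     (forall t, 0 <= t <= l -> is_derive_within (fun t => 0 <= t <= l) f t (f' t)) ->
     (forall t, 0 <= t <= l -> is_derive_within (fun t => 0 <= t <= l) g t (g' t)) ->
     forall t, (continuous (fun t => (g (cl t) - f (cl t)) ^ 2) t) /\
       (0 < t < l -> is_derive (fun t => (g (cl t) - f (cl t)) ^ 2) t
           (2 * (g (cl t) - f (cl t)) * (g' (cl t) - f' (cl t))))).
  { intros f f' g g' Hf Hg t; split.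
    - assert (C : continuous (fun t => g (cl t) - f (cl t)) t).
      { apply (continuous_minus (fun t => g (cl t)) (fun t => f (cl t)));
          eapply clamped_continuous; try lra; eassumption. }
      apply (continuous_ext (fun t => (g (cl t) - f (cl t)) * (g (cl t) - f (cl t)))).
      + intros y; apply (Rsqr_pow2 (g (cl y) - f (cl y))).
      + apply (continuous_mult (fun t => g (cl t) - f (cl t)) (fun t => g (cl t) - f (cl t)));
          exact C.
    - intros Ht.
      replace (2 * (g (cl t) - f (cl t)) * (g' (cl t) - f' (cl t)))
        with (INR 2 * (g' (cl t) - f' (cl t)) * (g (cl t) - f (cl t)) ^ pred 2) by (simpl; ring).
      apply (is_derive_pow (fun t => g (cl t) - f (cl t)) 2).
      unfold cl in *; rewrite (clamp_id l t) by lra.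
      apply (is_derive_minus (fun t => g (clamp l t)) (fun t => f (clamp l t)));
        apply clamped_derive; auto; [apply Hg | apply Hf]; lra. }
  assert (Dexp : forall t, is_derive (fun t => exp (- M * t)) t (- M * exp (- M * t)))
    by (intros t; auto_derive; [trivial | fold M; ring]).
  (* With the integrating factor exp (- M t) the product has nonpositive derivative; it starts at 0,
     which forces E s <= 0. *)
  destruct (MVT_gen (fun t => E t * exp (- M * t)) 0 s
              (fun t => (dE t - M * E t) * exp (- M * t))) as [z [Hz Eq]].
  - rewrite Rmin_left, Rmax_right by lra. intros t Ht.
    replace ((dE t - M * E t) * exp (- M * t))
      with (plus (mult (dE t) (exp (- M * t))) (mult (E t) (- M * exp (- M * t))))
      by (compute; ring).
    apply (is_derive_mult E (fun t => exp (- M * t))).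
    + assert (Ht' : 0 < t < l) by lra. unfold E, dE.
      apply (is_derive_plus (fun t => (k' (cl t) - k (cl t)) ^ 2 + (p' (cl t) - p (cl t)) ^ 2
                   + (q' (cl t) - q (cl t)) ^ 2) (fun t => (th' (cl t) - th (cl t)) ^ 2));
        [apply (is_derive_plus (fun t => (k' (cl t) - k (cl t)) ^ 2 + (p' (cl t) - p (cl t)) ^ 2)
             (fun t => (q' (cl t) - q (cl t)) ^ 2));
         [apply (is_derive_plus (fun t => (k' (cl t) - k (cl t)) ^ 2)
            (fun t => (p' (cl t) - p (cl t)) ^ 2))|]|].
      * now apply (DF k p k' p').
      * now apply (DF p q p' q').
      * rewrite (Rmult_minus_distr_l c).
        now apply (DF q (fun t => c * cos (th t)) q' (fun t => c * cos (th' t))).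
      * now apply (DF th k th' k').
    + apply Dexp.
    + intros; apply Rmult_comm.
  - intros t _; apply continuity_pt_filterlim.
    apply (continuous_mult E (fun t => exp (- M * t))).
    + unfold E.
      apply (continuous_plus (fun t => (k' (cl t) - k (cl t)) ^ 2 + (p' (cl t) - p (cl t)) ^ 2
                   + (q' (cl t) - q (cl t)) ^ 2) (fun t => (th' (cl t) - th (cl t)) ^ 2));
        [apply (continuous_plus (fun t => (k' (cl t) - k (cl t)) ^ 2 + (p' (cl t) - p (cl t)) ^ 2)
             (fun t => (q' (cl t) - q (cl t)) ^ 2));
         [apply (continuous_plus (fun t => (k' (cl t) - k (cl t)) ^ 2)
            (fun t => (p' (cl t) - p (cl t)) ^ 2))|]|].
      * now apply (DF k p k' p').
      * now apply (DF p q p' q').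
      * now apply (DF q (fun t => c * cos (th t)) q' (fun t => c * cos (th' t))).
      * now apply (DF th k th' k').
    + apply (ex_derive_continuous (fun t => exp (- M * t))); auto_derive; trivial.
  - assert (E0 : E 0 = 0).
    { unfold E, cl; rewrite clamp_id by lra.
      rewrite k0, k0', p0, p0', q0, q0', t0, t0'; ring. }
    assert (Es : E s <= 0).
    { apply (Rmult_le_reg_r (exp (- M * s))); [apply exp_pos|].
      rewrite E0 in Eq. specialize (Hle z). pose proof (exp_pos (- M * z)).
      assert (0 <= (M * E z - dE z) * exp (- M * z) * (s - 0))
        by (repeat apply Rmult_le_pos; lra). lra. }
    unfold E, cl in Es; rewrite clamp_id in Es by lra.
    pose proof (pow2_ge_0 (k' s - k s)); pose proof (pow2_ge_0 (p' s - p s)).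
    pose proof (pow2_ge_0 (q' s - q s)); pose proof (pow2_ge_0 (th' s - th s)).
    repeat split; apply Rminus_diag_uniq, Rsqr_0_uniq; unfold Rsqr; lra.
Qed.

(** * Curves with a given tangent angle *)

(* [auto_derive] leaves terms [Derive (fun x => f x) t], in eta-expanded form. *)
Ltac derive_value H :=
  lazymatch type of H with
  | is_derive ?f ?t ?d => rewrite (is_derive_unique (fun x : R => f x) t d H)
  end.

Lemma diff_on_sin_cos (n : nat) (D : R -> Prop) : diff_on n D sin /\ diff_on n D cos.
Proof.
  induction n as [|n [IHs IHc]]; [now split|].
  split.
  - exists cos; split; [intros x _; auto_derive; [trivial | ring] | exact IHc].
  - exists (fun x => (-1) * sin x); split.
    + intros x _; auto_derive; [trivial | ring].
    + apply diff_on_mult; [apply diff_on_const | exact IHs].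
Qed.

(** All geometry of a curve is derived from this relation, so waves and their dilations are treated
    alike. *)
Definition has_angle (g : curve) (Th : R -> R) : Prop :=
  forall s, is_derive (cx g) s (cos (Th s)) /\ is_derive (cy g) s (sin (Th s)).

(* [sol_energy] is the first integral of [Th'''' = c cos Th] that turns it into the
   Euler-Lagrange equation with multiplier [lam]. *)
Record elastic_angle (c lam : R) (Th k p q : R -> R) : Prop := {
  sol_Th : forall s, is_derive Th s (k s);
  sol_k : forall s, is_derive k s (p s);
  sol_p : forall s, is_derive p s (q s);
  sol_q : forall s, is_derive q s (c * cos (Th s));
  sol_energy : forall s, k s * q s - p s ^ 2 / 2 - c * sin (Th s) + lam = 0
}.

(** The derivative of the left side is p q + k c cos Th - p q - c k cos Th = 0, so the identity only
    has to be checked at 0. *)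
Lemma energy_of_initial (c lam : R) (Th k p q : R -> R) :
  (forall s, is_derive Th s (k s)) -> (forall s, is_derive k s (p s)) ->
  (forall s, is_derive p s (q s)) -> (forall s, is_derive q s (c * cos (Th s))) ->
  k 0 * q 0 - p 0 ^ 2 / 2 - c * sin (Th 0) + lam = 0 ->
  elastic_angle c lam Th k p q.
Proof.
  intros H1 H2 H3 H4 H0; split; auto.
  intros s; rewrite <- H0.
  apply (derive_zero_const (fun s => k s * q s - p s ^ 2 / 2 - c * sin (Th s) + lam)).
  intros t; auto_derive.
  - repeat split; eexists; eauto.
  - specialize (H1 t); specialize (H2 t); specialize (H3 t); specialize (H4 t).
    derive_value H1; derive_value H2; derive_value H3; derive_value H4. field.
Qed.

Section AngleCurve.

Variables (g : curve) (Th : R -> R).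
Hypothesis Hg : has_angle g Th.

Lemma Derive_cx (s : R) : Derive (cx g) s = cos (Th s).
Proof. apply is_derive_unique, Hg. Qed.

Lemma Derive_cy (s : R) : Derive (cy g) s = sin (Th s).
Proof. apply is_derive_unique, Hg. Qed.

Lemma velocity_angle (s : R) : velocity g s = (cos (Th s), sin (Th s)).
Proof. unfold velocity; now rewrite Derive_cx, Derive_cy. Qed.

Lemma speed_angle (s : R) : speed g s = 1.
Proof.
  unfold speed; rewrite Derive_cx, Derive_cy.
  replace (cos (Th s) ^ 2 + sin (Th s) ^ 2) with 1; [apply sqrt_1|].
  pose proof (sin2_cos2 (Th s)) as H; unfold Rsqr in H; lra.
Qed.

Lemma infinite_length_angle : infinite_length g.
Proof.
  unfold infinite_length.
  apply is_lim_ext with (fun r => 2 * r).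
  - intros r; rewrite (RInt_ext _ (fun _ => 1)) by (intros; apply speed_angle).
    rewrite RInt_const; compute; ring.
  - pose proof (is_lim_scal_l (fun r => r) 2 p_infty p_infty (is_lim_id p_infty)) as H.
    replace (Rbar_mult 2 p_infty) with p_infty in H; [exact H|].
    simpl; destruct (Rle_dec 0 2) as [L|L]; [|lra].
    destruct (Rle_lt_or_eq_dec 0 2 L); [reflexivity | lra].
Qed.

Variables (c lam : R) (k p q : R -> R).
Hypothesis HE : elastic_angle c lam Th k p q.

(** Bootstrapping: the four functions of the closed first-order system gain one order together. *)
Lemma angle_diff_on (n : nat) (D : R -> Prop) : diff_on n D Th.
Proof.
  destruct HE as [H1 H2 H3 H4 _].
  enough (H : diff_on n D Th /\ diff_on n D k /\ diff_on n D p /\ diff_on n D q) by apply H.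
  induction n as [|n [I1 [I2 [I3 I4]]]]; [now repeat split|].
  split; [exists k | split; [exists p | split; [exists q|]]]; try (split; auto; fail).
  exists (fun s => c * cos (Th s)); split; [auto|].
  apply diff_on_mult; [apply diff_on_const|].
  apply (diff_on_comp n D (fun _ => True)); auto. apply diff_on_sin_cos.
Qed.

Lemma smooth_angle : smooth_curve g.
Proof.
  split; intros n x _; apply (diff_on_ex_derive_n (fun _ => True)); auto using open_true;
    (destruct n as [|n]; [exact I|]).
  - exists (fun s => cos (Th s)); split; [intros s _; apply Hg|].
    apply (diff_on_comp n _ (fun _ => True)); auto; [apply diff_on_sin_cos | apply angle_diff_on].
  - exists (fun s => sin (Th s)); split; [intros s _; apply Hg|].
    apply (diff_on_comp n _ (fun _ => True)); auto; [apply diff_on_sin_cos | apply angle_diff_on].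
Qed.

Lemma unit_speed_immersion_angle : unit_speed_immersion g.
Proof.
  split; [split; [exact smooth_angle|]|]; intros t; rewrite speed_angle; [lra | reflexivity].
Qed.

Lemma curvature_angle (s : R) : curvature g s = k s.
Proof.
  unfold curvature; rewrite speed_angle, Derive_cx, Derive_cy.
  pose proof (sol_Th _ _ _ _ _ _ HE s) as D.
  assert (Ex : Derive_n (cx g) 2 s = k s * (- sin (Th s))).
  { transitivity (Derive (fun s => cos (Th s)) s);
      [apply Derive_ext; intros t; apply Derive_cx | apply is_derive_unique].
    apply (is_derive_comp cos Th); [apply is_derive_Reals, derivable_pt_lim_cos | exact D]. }
  assert (Ey : Derive_n (cy g) 2 s = k s * cos (Th s)).
  { transitivity (Derive (fun s => sin (Th s)) s);
      [apply Derive_ext; intros t; apply Derive_cy | apply is_derive_unique].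
    apply (is_derive_comp sin Th); [apply is_derive_Reals, derivable_pt_lim_sin | exact D]. }
  rewrite Ex, Ey.
  pose proof (sin2_cos2 (Th s)) as H; unfold Rsqr in H.
  replace (cos (Th s) * (k s * cos (Th s)) - sin (Th s) * (k s * - sin (Th s)))
    with (k s * (sin (Th s) * sin (Th s) + cos (Th s) * cos (Th s))) by ring.
  rewrite H; field.
Qed.

Lemma arclength_derive_angle (f f1 f2 : R -> R) (s : R) :
  (forall t, f t = f1 t) -> is_derive f1 s (f2 s) -> arclength_derive g f s = f2 s.
Proof.
  intros E D; unfold arclength_derive; rewrite speed_angle, (Derive_ext f f1) by exact E.
  rewrite (is_derive_unique _ _ _ D); field.
Qed.

(** Since k_sss = c cos Th, one has k_ssss = - c k sin Th, and the equation becomes k times the left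
    side of [sol_energy]. *)
Lemma stationary_angle : stationary lam g.
Proof.
  split; [apply unit_speed_immersion_angle|]; split; [exact infinite_length_angle|].
  destruct HE as [H1 H2 H3 H4 H5].
  assert (E1 : forall t, arclength_derive g (curvature g) t = p t)
    by (intros t; apply arclength_derive_angle with k; auto using curvature_angle).
  assert (E2 : forall t, arclength_derive g (arclength_derive g (curvature g)) t = q t)
    by (intros t; apply arclength_derive_angle with p; auto).
  assert (E3 : forall t, arclength_derive g (arclength_derive g
                 (arclength_derive g (curvature g))) t = c * cos (Th t))
    by (intros t; apply (arclength_derive_angle _ q (fun t => c * cos (Th t))); auto).
  intros k0 k_s k_ss k_sss k_ssss t; unfold k_ssss, k_sss, k_ss, k_s, k0; clear k0 k_s k_ss k_sss k_ssss.
  rewrite curvature_angle, E1, E2.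
  rewrite (arclength_derive_angle _ (fun t => c * cos (Th t)) (fun t => c * (k t * (- sin (Th t))))).
  - replace (c * (k t * - sin (Th t)) + k t ^ 2 * q t - 1 / 2 * k t * p t ^ 2 + lam * k t)
      with (k t * (k t * q t - p t ^ 2 / 2 - c * sin (Th t) + lam)) by field.
    rewrite H5; ring.
  - exact E3.
  - apply (is_derive_scal (fun t => cos (Th t)) t c).
    apply (is_derive_comp cos Th); [apply is_derive_Reals, derivable_pt_lim_cos | apply H1].
Qed.

End AngleCurve.

Lemma has_angle_dilate (rho : R) (g : curve) (Th : R -> R) :
  0 < rho -> has_angle g Th -> has_angle (dilate rho g) (fun s => Th (s / rho)).
Proof.
  intros Hr Hg s.
  assert (A : forall (f : R -> R) d, is_derive f (s / rho) d ->
             is_derive (fun s => rho * f (s / rho)) s d).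
  { intros f d Hf. replace d with (rho * (/ rho * d)) by (field; lra).
    apply (is_derive_scal (fun s => f (s / rho)) s rho).
    apply (is_derive_comp f (fun s => s / rho)); [exact Hf|].
    auto_derive; [trivial | field; lra]. }
  destruct (Hg (s / rho)) as [H1 H2]; split; [exact (A (cx g) _ H1) | exact (A (cy g) _ H2)].
Qed.

(** * Congruent curves *)

(** Without determining the isometry: it preserves |h(s) - h(t)|^2, and the mixed derivative of this
    function in s and t is - 2 times the inner product of the tangents at s and t, hence - 2 cos of
    the difference of angles. Reversal contributes sigma^2 = 1. *)
Lemma congruent_cos_angle (g h : curve) (Tg Th : R -> R) :
  has_angle g Tg -> has_angle h Th -> congruent g h ->
  exists sigma s0, (sigma = 1 \/ sigma = -1) /\
    forall s t, cos (Th s - Th t) = cos (Tg (sigma * s + s0) - Tg (sigma * t + s0)).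
Proof.
  intros Hg Hh [F [sigma [s0 [HF [Hs E]]]]].
  exists sigma, s0; split; [exact Hs|].
  assert (Hss : sigma * sigma = 1) by (destruct Hs as [-> | ->]; ring).
  set (G := fun s => g (sigma * s + s0)).
  assert (D2 : forall s t,
    (cx h s - cx h t) ^ 2 + (cy h s - cy h t) ^ 2
    = (cx G s - cx G t) ^ 2 + (cy G s - cy G t) ^ 2).
  { intros s t; pose proof (HF (g (sigma * s + s0)) (g (sigma * t + s0))) as H.
    rewrite <- !E in H; unfold dist_euc in H.
    apply sqrt_inj in H; [| apply Rplus_le_le_0_compat; apply Rle_0_sqr ..].
    unfold Rsqr in H; unfold G, cx, cy. lra. }
  assert (HG : forall s, is_derive (cx G) s (sigma * cos (Tg (sigma * s + s0))) /\
                         is_derive (cy G) s (sigma * sin (Tg (sigma * s + s0)))).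
  { intros s; split; [apply (is_derive_affine (cx g)) | apply (is_derive_affine (cy g))];
      apply Hg. }
  set (Y := fun s => Tg (sigma * s + s0)) in *.
  assert (D1 : forall s t,
    cos (Th s) * (cx h s - cx h t) + sin (Th s) * (cy h s - cy h t)
    = sigma * (cos (Y s) * (cx G s - cx G t) + sin (Y s) * (cy G s - cy G t))).
  { intros s t.
    assert (D : is_derive (fun s => (cx h s - cx h t) ^ 2 + (cy h s - cy h t) ^ 2
      - ((cx G s - cx G t) ^ 2 + (cy G s - cy G t) ^ 2)) s
      (2 * (cos (Th s) * (cx h s - cx h t) + sin (Th s) * (cy h s - cy h t)
      - sigma * (cos (Y s) * (cx G s - cx G t) + sin (Y s) * (cy G s - cy G t))))).
    { destruct (Hh s) as [A1 A2]; destruct (HG s) as [B1 B2].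
      auto_derive; [repeat split; eexists; eauto|].
      derive_value A1; derive_value A2; derive_value B1; derive_value B2. unfold Y; ring. }
    apply is_derive_unique in D.
    rewrite (Derive_ext _ (fun _ => 0)), Derive_const in D by (intros; rewrite D2; ring).
    lra. }
  intros s t.
  assert (D : is_derive (fun t => cos (Th s) * (cx h s - cx h t) + sin (Th s) * (cy h s - cy h t)
    - sigma * (cos (Y s) * (cx G s - cx G t) + sin (Y s) * (cy G s - cy G t))) t
    ((sigma * sigma) * (cos (Y s) * cos (Y t) + sin (Y s) * sin (Y t))
     - (cos (Th s) * cos (Th t) + sin (Th s) * sin (Th t)))).
  { destruct (Hh t) as [A1 A2]; destruct (HG t) as [B1 B2].
    auto_derive; [repeat split; eexists; eauto|].
    derive_value A1; derive_value A2; derive_value B1; derive_value B2. unfold Y; ring. }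
  apply is_derive_unique in D.
  rewrite (Derive_ext _ (fun _ => 0)), Derive_const in D by (intros; rewrite D1; ring).
  rewrite Hss in D. rewrite !cos_minus. unfold Y in D; lra.
Qed.

(** Comparison of second-order terms on the diagonal, where cos (X s - X t) is 1 - X'(t)^2 (s - t)^2
    / 2 + ... The sign of the derivative is lost here. *)
Lemma sq_derive_eq_of_cos_eq (X Y kx ky px py : R -> R) :
  (forall s, is_derive X s (kx s)) -> (forall s, is_derive kx s (px s)) ->
  (forall s, is_derive Y s (ky s)) -> (forall s, is_derive ky s (py s)) ->
  (forall s t, cos (X s - X t) = cos (Y s - Y t)) ->
  forall t, kx t ^ 2 = ky t ^ 2.
Proof.
  intros X1 X2 Y1 Y2 E t.
  assert (E1 : forall s, sin (X s - X t) * kx s = sin (Y s - Y t) * ky s).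
  { intros s.
    assert (D : is_derive (fun s => cos (X s - X t) - cos (Y s - Y t)) s
                 (sin (Y s - Y t) * ky s - sin (X s - X t) * kx s)).
    { auto_derive; [repeat split; eexists; eauto|].
      specialize (X1 s); specialize (Y1 s); derive_value X1; derive_value Y1; unfold Rminus; ring. }
    apply is_derive_unique in D.
    rewrite (Derive_ext _ (fun _ => 0)), Derive_const in D by (intros; rewrite E; ring).
    lra. }
  assert (D : is_derive (fun s => sin (X s - X t) * kx s - sin (Y s - Y t) * ky s) t
               (kx t ^ 2 - ky t ^ 2)).
  { auto_derive; [repeat split; eexists; eauto|].
    specialize (X1 t); specialize (Y1 t); derive_value X1; derive_value Y1.
    replace (X t + - X t) with 0 by ring; replace (Y t + - Y t) with 0 by ring.
    rewrite sin_0, cos_0; ring. }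
  apply is_derive_unique in D.
  rewrite (Derive_ext _ (fun _ => 0)), Derive_const in D by (intros; rewrite E1; ring).
  lra.
Qed.

Lemma eq_of_linear_bound (v w C : R) :
  (forall t, Rabs (v * t - w * t) <= C) -> v = w.
Proof.
  intros H; destruct (Req_dec v w) as [E|N]; [exact E|exfalso].
  assert (HN : v - w <> 0) by lra.
  specialize (H ((Rabs C + 1) / (v - w))).
  replace (v * ((Rabs C + 1) / (v - w)) - w * ((Rabs C + 1) / (v - w))) with (Rabs C + 1) in H
    by (field; lra).
  pose proof (Rabs_pos C); pose proof (Rle_abs C). rewrite Rabs_right in H; lra.
Qed.

(** Positivity restores the sign, so [kh t] = [kg (sigma * t + s0)]. Hence
    [Th t - sigma * Tg (sigma * t + s0)] is constant, and as each angle stays within bounded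
    distance of a linear function, the two slopes agree. *)
Lemma congruent_turning_rate (g h : curve) (Tg kg pg Th kh ph : R -> R) (wg wh Bg Bh : R) :
  has_angle g Tg -> has_angle h Th ->
  (forall s, is_derive Tg s (kg s)) -> (forall s, is_derive kg s (pg s)) ->
  (forall s, is_derive Th s (kh s)) -> (forall s, is_derive kh s (ph s)) ->
  (forall s, 0 < kg s) -> (forall s, 0 < kh s) ->
  (forall s, Rabs (Tg s - wg * s) <= Bg) -> (forall s, Rabs (Th s - wh * s) <= Bh) ->
  congruent g h -> wg = wh.
Proof.
  intros Hg Hh G1 G2 H1 H2 Pg Ph Lg Lh C.
  destruct (congruent_cos_angle g h Tg Th Hg Hh C) as [sigma [s0 [Hs E]]].
  assert (Hss : sigma * sigma = 1) by (destruct Hs as [-> | ->]; ring).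
  assert (Y1 : forall s, is_derive (fun s => Tg (sigma * s + s0)) s (sigma * kg (sigma * s + s0)))
    by (intros s; apply is_derive_affine, G1).
  assert (Y2 : forall s, is_derive (fun s => sigma * kg (sigma * s + s0)) s
                (sigma * (sigma * pg (sigma * s + s0)))).
  { intros s; apply (is_derive_scal (fun s => kg (sigma * s + s0))), is_derive_affine, G2. }
  pose proof (sq_derive_eq_of_cos_eq _ _ _ _ _ _ H1 H2 Y1 Y2 E) as SQ.
  assert (K : forall t, kh t = kg (sigma * t + s0)).
  { intros t; specialize (SQ t); simpl in SQ.
    pose proof (Pg (sigma * t + s0)) as P1; pose proof (Ph t) as P2.
    set (u := kh t) in *; set (v := kg (sigma * t + s0)) in *.
    assert ((u - v) * (u + v) = 0).
    { replace ((u - v) * (u + v)) with (u * (u * 1) - (sigma * sigma) * (v * v)) by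
        (rewrite Hss; ring). rewrite SQ; ring. }
    apply Rmult_integral in H; lra. }
  assert (L : forall t, Th t - sigma * Tg (sigma * t + s0) = Th 0 - sigma * Tg (sigma * 0 + s0)).
  { intros t; apply (derive_zero_const (fun t => Th t - sigma * Tg (sigma * t + s0))); intros s.
    replace 0 with (minus (kh s) (sigma * (sigma * kg (sigma * s + s0)))).
    - apply (is_derive_minus Th (fun t => sigma * Tg (sigma * t + s0))); [apply H1|].
      apply (is_derive_scal (fun t => Tg (sigma * t + s0))), Y1.
    - rewrite K, <- Rmult_assoc, Hss; compute; ring. }
  set (K0 := Th 0 - sigma * Tg (sigma * 0 + s0)) in *.
  apply eq_of_linear_bound with (Rabs K0 + Bg + Bh + Rabs (sigma * wg * s0)); intros t.
  specialize (L t). specialize (Lg (sigma * t + s0)). specialize (Lh t).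
  set (eg := Tg (sigma * t + s0) - wg * (sigma * t + s0)) in *.
  set (eh := Th t - wh * t) in *.
  replace (wg * t - wh * t) with (eh - sigma * eg - K0 - sigma * wg * s0).
  2:{ unfold eh, eg; rewrite <- L.
      replace (wg * t) with ((sigma * sigma) * (wg * t)) by (rewrite Hss; ring). ring. }
  assert (Rabs (sigma * eg) = Rabs eg).
  { rewrite Rabs_mult; destruct Hs as [-> | ->];
      [rewrite Rabs_R1 | rewrite (Rabs_left (-1)) by lra]; ring. }
  pose proof (Rabs_triang (eh - sigma * eg - K0) (- (sigma * wg * s0))) as T1.
  pose proof (Rabs_triang (eh - sigma * eg) (- K0)) as T2.
  pose proof (Rabs_triang eh (- (sigma * eg))) as T3.
  rewrite Rabs_Ropp in T1, T2, T3. unfold Rminus in *. lra.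
Qed.

(** * The waves *)

Ltac Rring :=
  repeat match goal with
  | |- context [@plus ?G ?x ?y] => change (@plus G x y) with (x + y)
  | |- context [@minus ?G ?x ?y] => change (@minus G x y) with (x - y)
  end; lazymatch goal with |- @eq _ ?x ?y => change (@eq R x y) end; ring.

Lemma has_angle_ext (g : curve) (Th Th' : R -> R) :
  (forall s, Th s = Th' s) -> has_angle g Th -> has_angle g Th'.
Proof. intros E H s; rewrite <- E; apply H. Qed.

Lemma wave_has_angle (l : R) (N : nat) (th Th : R -> R) :
  (forall s, extend_angle l N th s = Th s) -> (forall s, continuous Th s) ->
  has_angle (wave l N th) Th.
Proof.
  intros E C s.
  assert (H : forall f : R -> R, (forall x, continuous f x) ->
    is_derive (fun s => RInt (fun t => f (extend_angle l N th t)) 0 s) s (f (Th s))).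
  { intros f Hf; apply (is_derive_ext (prim (fun t => f (Th t)))).
    - intros t; apply RInt_ext; intros x _; now rewrite E.
    - apply (prim_derive (fun t => f (Th t))).
      intros y; now apply (continuous_comp Th f). }
  split; [apply (H cos) | apply (H sin)].
  - apply cos_even_periodic.
  - apply sin_odd_periodic.
Qed.

Definition wave_angle (A mu s : R) : R := PI / 2 + A * s + angle mu (A * s).

Section Wave.

Variables (A mu : R).
Hypotheses (HA : 0 < A) (Hmu : Rabs mu * 8192 < 1).

Let k (s : R) : R := A * (1 + angle1 mu (A * s)).
Let p (s : R) : R := A ^ 2 * angle2 mu (A * s).
Let q (s : R) : R := A ^ 3 * angle3 mu (A * s).

Lemma is_derive_scaled (f f' : R -> R) (a s : R) :
  (forall x, is_derive f x (f' x)) ->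
  is_derive (fun s => a * f (A * s)) s (a * A * f' (A * s)).
Proof.
  intros Hf; rewrite Rmult_assoc; apply (is_derive_scal (fun s => f (A * s)) s a).
  apply (is_derive_comp f (fun s => A * s)); [apply Hf|].
  auto_derive; [trivial | ring].
Qed.

(** Each derivative in s brings a factor A, whence c = A^4 mu; the energy vanishes at 0 by the
    definition of [stretch]. *)
Lemma wave_elastic :
  elastic_angle (A ^ 4 * mu) (A ^ 4 * stretch mu) (wave_angle A mu) k p q.
Proof.
  assert (C : forall x, cos (PI / 2 + A * x + angle mu (A * x)) = - sin (A * x + angle mu (A * x)))
    by (intros x; rewrite Rplus_assoc, cos_plus, cos_PI2, sin_PI2; ring).
  apply energy_of_initial.
  - intros s; unfold wave_angle, k.
    replace (A * (1 + angle1 mu (A * s))) with (plus A (1 * A * angle1 mu (A * s))) by Rring.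
    apply (is_derive_plus (fun s => PI / 2 + A * s) (fun s => angle mu (A * s))).
    + auto_derive; [trivial | ring].
    + apply (is_derive_ext (fun s => 1 * angle mu (A * s))); [intros t; apply Rmult_1_l|].
      apply is_derive_scaled; intros x; now apply angle_derive.
  - intros s; unfold k, p.
    apply (is_derive_ext (fun s => plus A (A * angle1 mu (A * s)))).
    { intros t; Rring. }
    replace (A ^ 2 * angle2 mu (A * s)) with (plus 0 (A * A * angle2 mu (A * s))) by Rring.
    apply (is_derive_plus (fun _ => A) (fun s => A * angle1 mu (A * s))).
    + apply (is_derive_const A).
    + apply is_derive_scaled; intros x; now apply angle1_derive.
  - intros s; unfold p, q. replace (A ^ 3) with (A ^ 2 * A) by ring.
    apply is_derive_scaled; intros x; now apply angle2_derive.
  - intros s; unfold wave_angle; rewrite C; unfold q.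
    replace (A ^ 4 * mu * - sin (A * s + angle mu (A * s)))
      with (A ^ 3 * A * (- mu * sin (A * s + angle mu (A * s)))) by ring.
    apply (is_derive_scaled (angle3 mu) (fun x => - mu * sin (x + angle mu x))).
    intros x; now apply angle3_derive.
  - unfold wave_angle, k, p, q; rewrite !Rmult_0_r.
    rewrite (odd_periodic_at_0 (angle mu)) by now apply angle_odd_periodic.
    rewrite (odd_periodic_at_0 (angle2 mu)) by now apply angle2_odd_periodic.
    rewrite !Rplus_0_r, sin_PI2; unfold stretch; field.
Qed.

Lemma wave_curvature_pos (s : R) : 0 < k s.
Proof.
  pose proof (angle1_bound mu Hmu (A * s)) as H; apply Rabs_def2 in H.
  apply Rmult_lt_0_compat; lra.
Qed.

Lemma wave_angle_linear_bound (s : R) :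
  Rabs (wave_angle A mu s - A * s) <= PI / 2 + 1.
Proof.
  unfold wave_angle; pose proof (angle_bound mu Hmu (A * s)) as H.
  apply Rabs_le_between in H; pose proof PI_RGT_0; apply Rabs_le; lra.
Qed.

Lemma wave_angle_continuous (s : R) : continuous (wave_angle A mu) s.
Proof. eapply is_derive_continuous; apply (sol_Th _ _ _ _ _ _ wave_elastic). Qed.

Variables (l : R) (N : nat).
Hypotheses (Hl : 0 < l) (HAl : A * l = half_turns N).

Let odd_turns : nat := (2 * N + 1)%nat.

(** The arc covers N + 1/2 periods of [angle], so the doubled arc covers a whole number of them. *)
Lemma two_half_turns : A * (2 * l) = INR odd_turns * (2 * PI).
Proof.
  unfold odd_turns; rewrite plus_INR, mult_INR.
  replace (A * (2 * l)) with (2 * (A * l)) by ring.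
  rewrite HAl; unfold half_turns; simpl; ring.
Qed.

Lemma angle_shift (s : R) : angle mu (A * (s + 2 * l)) = angle mu (A * s).
Proof.
  rewrite Rmult_plus_distr_l, two_half_turns.
  rewrite (shift_iter (angle mu) (2 * PI) 0); [ring|].
  intros y; rewrite Rplus_0_r; now apply angle_odd_periodic.
Qed.

Lemma wave_angle_shift (s : R) :
  wave_angle A mu (s + 2 * l) = wave_angle A mu s + 2 * INR odd_turns * PI.
Proof.
  unfold wave_angle; rewrite angle_shift.
  pose proof two_half_turns. rewrite Rmult_plus_distr_l; lra.
Qed.

Lemma wave_angle_reflect (s : R) :
  wave_angle A mu s = PI + 2 * half_turns N - wave_angle A mu (2 * l - s).
Proof.
  unfold wave_angle.
  replace (A * (2 * l - s)) with (A * (- s + 2 * l)) at 2 by ring.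
  rewrite angle_shift, <- HAl.
  replace (A * - s) with (- (A * s)) by ring.
  destruct (angle_odd_periodic mu Hmu) as [_ [Ho _]]; rewrite Ho; lra.
Qed.

(** The periodic solution already obeys both rules of the extension: the reflection about l comes
    from oddness and periodicity of [angle], the shift by 2 l from periodicity alone. *)
Lemma extend_wave_angle (th : R -> R) (s : R) :
  (forall t, 0 <= t <= l -> th t = wave_angle A mu t) ->
  extend_angle l N th s = wave_angle A mu s.
Proof.
  intros Hth.
  destruct (shift_reduce (wave_angle A mu) (2 * l) (2 * INR odd_turns * PI) 0)
    with (x := s) as [m [y [Hy [Es Ew]]]]; [lra | exact wave_angle_shift |].
  rewrite Ew, Es.
  replace (y + IZR m * (2 * l)) with (y + 2 * IZR m * l) by ring.
  rewrite extend_angle_shift; [| lra | | lra].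
  - f_equal.
    + unfold reflect_angle; destruct (Rle_dec y l) as [L|L].
      * apply Hth; lra.
      * rewrite Hth by lra; symmetry; apply wave_angle_reflect.
    + pose proof two_half_turns as H. rewrite <- HAl.
      replace (2 * IZR m * (A * l)) with (IZR m * (A * (2 * l))) by ring.
      rewrite H; ring.
  - rewrite Hth by lra; unfold wave_angle; rewrite Rmult_0_r.
    rewrite (odd_periodic_at_0 (angle mu)) by now apply angle_odd_periodic. ring.
Qed.

Variable g : curve.
Hypotheses (Hg : has_angle g (wave_angle A mu)) (g0 : g 0 = (0, 0)).

Lemma velocity_shift (s : R) : velocity g (s + 2 * l) = velocity g s.
Proof.
  rewrite !(velocity_angle g _ Hg), wave_angle_shift.
  now rewrite cos_period, sin_period.
Qed.

Lemma coordinate_shift (f f' : R -> R) :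
  (forall s, is_derive f s (f' s)) -> (forall s, f' (s + 2 * l) = f' s) -> f 0 = 0 ->
  forall s, f (s + 2 * l) = f s + f (2 * l).
Proof.
  intros Df Hp f0 s.
  assert (E : f (s + 2 * l) - f s = f (0 + 2 * l) - f 0).
  { apply (derive_zero_const (fun s => f (s + 2 * l) - f s)); intros t.
    replace 0 with (minus (f' (t + 2 * l)) (f' t)) by (rewrite Hp; Rring).
    apply (is_derive_minus (fun s => f (s + 2 * l)) f); [apply is_derive_shift|]; apply Df. }
  rewrite Rplus_0_l in E; lra.
Qed.

Lemma cx_shift (s : R) : cx g (s + 2 * l) = cx g s + cx g (2 * l).
Proof.
  apply (coordinate_shift (cx g) (fun s => cos (wave_angle A mu s))).
  - apply Hg.
  - intros t; now rewrite wave_angle_shift, cos_period.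
  - unfold cx; now rewrite g0.
Qed.

Lemma cy_shift (s : R) : cy g (s + 2 * l) = cy g s + cy g (2 * l).
Proof.
  apply (coordinate_shift (cy g) (fun s => sin (wave_angle A mu s))).
  - apply Hg.
  - intros t; now rewrite wave_angle_shift, sin_period.
  - unfold cy; now rewrite g0.
Qed.

Let h (x : R) : R := cos (x + angle mu x).

Lemma h_even_periodic : even_periodic h.
Proof.
  destruct (angle_odd_periodic mu Hmu) as [Hc [Ho Hp]]; unfold h; split; [|split].
  - intros x; apply (continuous_comp (fun x => x + angle mu x) cos).
    + apply (continuous_plus (fun x => x) (angle mu)); [apply continuous_id | apply Hc].
    + apply cos_even_periodic.
  - intros x; rewrite Ho, <- (cos_neg (x + angle mu x)); f_equal; ring.
  - intros x; rewrite Hp. replace (x + 2 * PI + angle mu x) with (x + angle mu x + 2 * PI) by ring.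
    apply cos_even_periodic.
Qed.

(** Since sin (PI / 2 + z) = cos z, A times the second coordinate is the primitive of [h] at A s,
    which gains 2 [prim h PI] over each of the 2 N + 1 periods. *)
Lemma cy_period : cy g (2 * l) = INR odd_turns * (2 * prim h PI) / A.
Proof.
  assert (E : forall s, A * cy g s = prim h (A * s)).
  { intros s.
    enough (H : A * cy g s - 1 * prim h (A * s) = A * cy g 0 - 1 * prim h (A * 0)).
    { rewrite Rmult_0_r, prim_zero in H; unfold cy in H |- *; rewrite g0 in H; simpl in H; lra. }
    apply (derive_zero_const (fun s => A * cy g s - 1 * prim h (A * s))); intros t.
    replace 0 with (minus (A * sin (wave_angle A mu t)) (1 * A * h (A * t))).
    - apply (is_derive_minus (fun s => A * cy g s) (fun s => 1 * prim h (A * s))).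
      + apply (is_derive_scal (cy g) t A), Hg.
      + apply is_derive_scaled; intros x; apply prim_derive, h_even_periodic.
    - unfold wave_angle, h. rewrite Rplus_assoc, sin_plus, cos_PI2, sin_PI2; Rring. }
  apply (Rmult_eq_reg_l A); [|lra]. rewrite E, two_half_turns.
  rewrite <- (Rplus_0_l (INR odd_turns * (2 * PI))).
  rewrite (shift_iter (prim h) (2 * PI) (2 * prim h PI)), prim_zero.
  - field; lra.
  - intros y; apply prim_even_shift, h_even_periodic.
Qed.

Hypothesis Hh : prim h PI <> 0.

Lemma cy_period_neq_0 : cy g (2 * l) <> 0.
Proof.
  rewrite cy_period; unfold Rdiv.
  repeat apply Rmult_integral_contrapositive_currified; try lra.
  - apply not_0_INR; unfold odd_turns; lia.
  - apply Rinv_neq_0_compat; lra.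
Qed.

(** A period T, unrelated to 2 l, would bring the second coordinate back to 0 at every multiple of
    T, whereas it drifts by [d] per 2 l and deviates from this drift by at most 2 l. *)
Lemma wave_not_closed : ~ closed_curve g.
Proof.
  intros [T [HT E]].
  set (d := cy g (2 * l)).
  assert (Hd : 0 < Rabs d) by (apply Rabs_pos_lt, cy_period_neq_0).
  (* n T exceeds 2 l by so much that the m complete periods before it satisfy m |d| > 2 l. *)
  destruct (INR_unbounded (((2 * l) * (2 * l) / Rabs d + 2 * l) / T)) as [n Hn].
  assert (Hn' : (2 * l) * (2 * l) / Rabs d + 2 * l < INR n * T) by (now apply Rlt_div_l).
  assert (c0 : cy g 0 = 0) by (unfold cy; now rewrite g0).
  assert (Ec : cy g (INR n * T) = 0).
  { rewrite <- (Rplus_0_l (INR n * T)), (shift_iter (cy g) T 0), c0; [ring|].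
    intros y; unfold cy; rewrite E; ring. }
  destruct (shift_reduce (cy g) (2 * l) d 0) with (x := INR n * T) as [m [y [Hy [Ex Ey]]]];
    [lra | exact cy_shift |].
  assert (Lip : Rabs (cy g y) <= 2 * l).
  { pose proof (Rabs_sub_le_of_derive (cy g) (fun s => sin (wave_angle A mu s)) 1 0 y) as L.
    rewrite c0, !Rminus_0_r, (Rabs_right y) in L by lra.
    enough (Rabs (cy g y) <= 1 * y) by lra. apply L.
    - apply Hg.
    - intros z; pose proof (SIN_bound (wave_angle A mu z)); apply Rabs_le; lra. }
  rewrite Ec in Ey.
  assert (Ed : IZR m * (2 * l) * Rabs d = Rabs (cy g y) * (2 * l)).
  { replace (cy g y) with (- (IZR m * d)) by lra.
    rewrite Rabs_Ropp, Rabs_mult.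
    assert (Hm : 0 <= IZR m).
    { apply (Rmult_le_reg_r (2 * l)); [lra|]. rewrite Rmult_0_l.
      assert (0 <= 2 * l * (2 * l) / Rabs d) by (apply Rdiv_le_0_compat; nra). lra. }
    rewrite (Rabs_right (IZR m)) by lra. ring. }
  assert (Hlt : (2 * l) * (2 * l) / Rabs d < IZR m * (2 * l)) by lra.
  apply (Rlt_div_l _ _ (Rabs d)) in Hlt; [|lra].
  pose proof (Rmult_le_compat_r (2 * l) _ _ ltac:(lra) Lip); lra.
Qed.

Lemma wave_turning_rate : mean_turning_rate g A.
Proof.
  split; [apply (unit_speed_immersion_angle g _ Hg _ _ _ _ _ wave_elastic)|].
  split; [split|].
  - exists (2 * l); split; [lra | exact velocity_shift].
  (* The angles at 0 and l differ by an odd multiple of PI, so the tangents there are opposite. *)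
  - exists 0, l; rewrite !(velocity_angle g _ Hg). intros E; injection E; intros E2 _.
    assert (E3 : wave_angle A mu l = wave_angle A mu 0 + PI + 2 * INR N * PI).
    { pose proof (wave_angle_reflect l) as R1; replace (2 * l - l) with l in R1 by ring.
      unfold wave_angle at 2; rewrite Rmult_0_r, (odd_periodic_at_0 (angle mu))
        by now apply angle_odd_periodic.
      unfold half_turns in R1; lra. }
    rewrite E3, sin_period, neg_sin in E2.
    assert (E4 : wave_angle A mu 0 = PI / 2).
    { unfold wave_angle; rewrite Rmult_0_r, (odd_periodic_at_0 (angle mu))
        by now apply angle_odd_periodic. ring. }
    rewrite E4, sin_PI2 in E2; lra.
  - exists (wave_angle A mu); split.
    + split; [exact wave_angle_continuous | intros s; apply (velocity_angle g _ Hg)].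
    (* Twice the bound PI / 2 + 1, once for each of the two angles. *)
    + set (C := PI + 2).
      assert (B : forall r, 0 < r -> A - C / r <= Rabs (wave_angle A mu r - wave_angle A mu 0) / r
                                     <= A + C / r).
      { intros r Hr.
        pose proof (wave_angle_linear_bound r) as B1; pose proof (wave_angle_linear_bound 0) as B0.
        apply Rabs_le_between in B1; apply Rabs_le_between in B0.
        rewrite Rmult_0_r in B0.
        assert (B2 : Rabs (wave_angle A mu r - wave_angle A mu 0 - A * r) <= C)
          by (apply Rabs_le; unfold C; lra).
        pose proof (Rabs_triang_inv (A * r) (A * r - (wave_angle A mu r - wave_angle A mu 0))) as T1.
        pose proof (Rabs_triang (wave_angle A mu r - wave_angle A mu 0 - A * r) (A * r)) as T2.
        replace (A * r - (A * r - (wave_angle A mu r - wave_angle A mu 0)))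
          with (wave_angle A mu r - wave_angle A mu 0) in T1 by ring.
        replace (wave_angle A mu r - wave_angle A mu 0 - A * r + A * r)
          with (wave_angle A mu r - wave_angle A mu 0) in T2 by ring.
        rewrite (Rabs_minus_sym (A * r)) in T1.
        assert (HAr : 0 < A * r) by (now apply Rmult_lt_0_compat).
        rewrite (Rabs_right (A * r)) in T1, T2 by lra.
        split.
        - apply (Rmult_le_reg_r r); [exact Hr|]. unfold Rdiv.
          rewrite Rmult_minus_distr_r, !Rmult_assoc, Rinv_l, !Rmult_1_r by lra. lra.
        - apply (Rmult_le_reg_r r); [exact Hr|]. unfold Rdiv.
          rewrite Rmult_plus_distr_r, !Rmult_assoc, Rinv_l, !Rmult_1_r by lra. lra. }
      assert (L : is_lim (fun r => C / r) p_infty 0).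
      { replace (Finite 0) with (Rbar_mult C (Rbar_inv p_infty)) by (simpl; f_equal; ring).
        apply (is_lim_scal_l Rinv). apply (is_lim_inv (fun r => r)); [apply is_lim_id | easy]. }
      apply (is_lim_le_le_loc (fun r => A - C / r) (fun r => A + C / r)).
      * exists 0; intros r Hr; apply B, Hr.
      * replace (Finite A) with (Finite (A - 0)) by (f_equal; ring).
        apply is_lim_minus'; [apply is_lim_const | exact L].
      * replace (Finite A) with (Finite (A + 0)) by (f_equal; ring).
        apply is_lim_plus'; [apply is_lim_const | exact L].
Qed.

End Wave.

(** * From the universal family to the branches *)

Lemma diff_on_subset (n : nat) (D E : R -> Prop) (f : R -> R) :
  (forall x, D x -> E x) -> diff_on n E f -> diff_on n D f.
Proof.
  intros H; revert f; induction n as [|n IH]; intros f; [easy|].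
  intros [f' [F1 F2]]; exists f'; split; [intros x Hx; apply F1; auto | auto].
Qed.

(* [y = angle3 mu PI] is the value at [PI] of the third derivative, that is [epsilon] rescaled. *)
Lemma branch_parameter : exists (r : R) (mu : R -> R),
  0 < r /\ mu 0 = 0 /\
  (forall y, Rabs y < r -> small (mu y) /\ angle3 (mu y) PI = y /\
     (y <> 0 -> 0 < stretch (mu y) /\ prim (fun x => cos (x + angle (mu y) x)) PI <> 0)) /\
  (forall n, diff_on n (fun y => Rabs y < r) mu).
Proof.
  destruct stretch_pos_near_0 as [m [Hm Hpos]].
  destruct angle3_PI_derive_0 as [z0 d0].
  destruct (local_inverse (fun mu => - angle3 mu PI) m 1) as [r [g [Hr [g0 [Hg Sg]]]]];
    [lra | rewrite z0; ring | lra | exact d0 | |].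
  { intros n; apply diff_on_subset with small; [unfold small; intros x Hx; lra|].
    apply diff_on_ext with (fun mu => (-1) * angle3 mu PI);
      [apply open_Rabs_lt | intros; ring|].
    apply diff_on_mult; [apply diff_on_const | apply angle3_diff_on]. }
  (* [g] inverts - [angle3], so its argument is negated. *)
  exists r, (fun y => g ((-1) * y)).
  assert (HN : forall y, Rabs y < r -> Rabs ((-1) * y) < r).
  { intros y Hy; replace (-1 * y) with (- y) by ring; now rewrite Rabs_Ropp. }
  split; [exact Hr|]; split; [now rewrite Rmult_0_r|]; split.
  - intros y Hy; destruct (Hg _ (HN y Hy)) as [G1 G2].
    split; [unfold small; lra|]. split; [lra|].
    (* A nonzero value y excludes [mu] = 0, where [angle3] vanishes. *)
    intros Hy0; apply Hpos; split; [|exact G1].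
    apply Rabs_pos_lt; intros E; rewrite E, z0 in G2; lra.
  - intros n; apply (diff_on_comp n _ (fun y => Rabs y < r)); [exact HN | apply Sg|].
    apply diff_on_mult; [apply diff_on_const | apply diff_on_id].
Qed.

Lemma stretch_diff_on (n : nat) : diff_on n small stretch.
Proof.
  apply diff_on_ext with (fun mu => mu + (-1) * ((1 + angle1 mu 0) * angle3 mu 0));
    [apply open_Rabs_lt | intros; unfold stretch; ring|].
  apply diff_on_plus; [apply diff_on_id|].
  apply diff_on_mult; [apply diff_on_const|].
  apply diff_on_mult; [apply diff_on_plus; [apply diff_on_const | apply angle1_diff_on]|].
  apply angle3_diff_on.
Qed.

Definition rate (l : R) (N : nat) : R := (2 * INR N + 1) * PI / l.

Lemma rate_pos (l : R) (N : nat) : 0 < l -> 0 < rate l N.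
Proof.
  intros Hl; pose proof PI_RGT_0; pose proof (pos_INR N).
  apply Rdiv_lt_0_compat; [apply Rmult_lt_0_compat; lra | exact Hl].
Qed.

Lemma rate_inj (l : R) (N M : nat) : 0 < l -> rate l N = rate l M -> N = M.
Proof.
  unfold rate; intros Hl E; pose proof PI_RGT_0; apply INR_eq.
  apply (Rmult_eq_compat_r (l / PI)) in E.
  replace ((2 * INR N + 1) * PI / l * (l / PI)) with (2 * INR N + 1) in E by (field; lra).
  replace ((2 * INR M + 1) * PI / l * (l / PI)) with (2 * INR M + 1) in E by (field; lra).
  lra.
Qed.

Lemma wave_congruent_rate (A A' mu mu' : R) (g h : curve) :
  0 < A -> 0 < A' -> small mu -> small mu' ->
  has_angle g (wave_angle A mu) -> has_angle h (wave_angle A' mu') ->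
  congruent g h -> A = A'.
Proof.
  intros HA HA' Hmu Hmu' Hg Hh C.
  apply small_lt1 in Hmu; apply small_lt1 in Hmu'.
  pose proof (wave_elastic A mu Hmu) as [G1 G2 _ _ _].
  pose proof (wave_elastic A' mu' Hmu') as [H1 H2 _ _ _].
  exact (congruent_turning_rate g h _ _ _ _ _ _ A A' _ _ Hg Hh G1 G2 H1 H2
           (wave_curvature_pos A mu HA Hmu) (wave_curvature_pos A' mu' HA' Hmu')
           (wave_angle_linear_bound A mu Hmu) (wave_angle_linear_bound A' mu' Hmu') C).
Qed.

(** Dilation stays in the two-parameter family: it divides A by rho and keeps [mu]. *)
Lemma wave_angle_dilate (A rho mu s : R) :
  rho <> 0 -> wave_angle A mu (s / rho) = wave_angle (A / rho) mu s.
Proof.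
  intros H; unfold wave_angle.
  replace (A * (s / rho)) with (A / rho * s) by (now field); reflexivity.
Qed.

(** Each choice takes the value reached by the previous one as its upper bound, which makes all
    values distinct. *)
Lemma strictly_decreasing_choice (P : nat -> R -> Prop) (v : nat -> R -> R) :
  (forall N y, 0 < y -> exists e, P N e /\ 0 < v N e < y) ->
  exists e : nat -> R, (forall N, P N (e N)) /\
    forall N M, (N < M)%nat -> v M (e M) < v N (e N).
Proof.
  intros H.
  (* Positivity of the bound is moved inside the existential to make the choice function total. *)
  assert (H' : forall z : nat * R, exists e, 0 < snd z -> P (fst z) e /\ 0 < v (fst z) e < snd z).
  { intros [N y]; simpl; destruct (Rlt_dec 0 y) as [L|L].
    - destruct (H N y L) as [e He]; now exists e.
    - exists 0; easy. }
  destruct (functional_choice _ H') as [pick Hp].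
  (* [val n] is the bound imposed on choice n; the initial 1 is arbitrary. *)
  set (val := fix val n := match n with O => 1 | S m => v m (pick (m, val m)) end).
  assert (Hv : forall n, 0 < val n).
  { induction n as [|n IH]; simpl; [lra|]. apply (Hp (n, val n) IH). }
  exists (fun n => pick (n, val n)); split.
  - intros N; apply (Hp (N, val N) (Hv N)).
  - intros N M HM; change (val (S M) < val (S N)).
    assert (St : forall n, val (S n) < val n) by (intros n; apply (Hp (n, val n) (Hv n))).
    induction HM as [|M HM IH]; [apply St|].
    apply Rlt_trans with (val (S M)); [apply St | exact IH].
Qed.

Theorem theorem1p3 (l : R) (hl : 0 < l) :
  exists (eps0 : nat -> R) (a b lam : nat -> R -> R)
         (k p q th : nat -> R -> R -> R),
    (forall N : nat,
        0 < eps0 N /\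
        smooth_on (fun e => Rabs e < eps0 N) (a N) /\
        smooth_on (fun e => Rabs e < eps0 N) (b N) /\
        smooth_on (fun e => Rabs e < eps0 N) (lam N) /\
        a N 0 = (2 * INR N + 1) * PI / l /\ b N 0 = 0 /\ lam N 0 = 0 /\
        (forall e : R, Rabs e < eps0 N ->
           the_arc_solution l (a N e) (b N e) (lam N e)
             (k N e) (p N e) (q N e) (th N e) /\
           th N e l = PI / 2 + (2 * INR N + 1) * PI /\
           p N e l = 0 /\
           q N e l = e)) /\
    (* (i) *)
    (forall N : nat, exists delta : R, 0 < delta <= eps0 N /\
        forall e : R, 0 < Rabs e < delta -> 0 < lam N e) /\
    (* (ii) *)
    (forall (N : nat) (e : R), 0 < Rabs e < eps0 N ->
        unit_speed_immersion (wave l N (th N e)) /\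
        stationary (lam N e) (wave l N (th N e)) /\
        (forall s, velocity (wave l N (th N e)) (s + 2 * l) =
                   velocity (wave l N (th N e)) s) /\
        (exists P : R * R, P <> (0, 0) /\
           forall s, wave l N (th N e) (s + 2 * l) =
                     (fst (wave l N (th N e) s) + fst P,
                      snd (wave l N (th N e) s) + snd P)) /\
        ~ closed_curve (wave l N (th N e))) /\
    (* (iii) *)
    (forall (N M : nat) (e e' : R), N <> M ->
        0 < Rabs e < eps0 N -> 0 < Rabs e' < eps0 M ->
        ~ congruent (wave l N (th N e)) (wave l M (th M e'))) /\
    (forall (N : nat) (e : R), 0 < Rabs e < eps0 N ->
        mean_turning_rate (wave l N (th N e)) ((2 * INR N + 1) * PI / l)) /\
    (* (iv) *)
    (forall lamstar : R, 0 < lamstar ->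
       forall eta : nat -> R, (forall N : nat, 0 < eta N) ->
       exists e rho : nat -> R,
         (forall N : nat,
            0 < Rabs (e N) < eps0 N /\ Rabs (e N) < eta N /\ 0 < rho N /\
            circular_wave l eps0 th (dilate (rho N) (wave l N (th N (e N)))) /\
            stationary lamstar (dilate (rho N) (wave l N (th N (e N))))) /\
         (forall N M : nat, N <> M ->
            ~ congruent (dilate (rho N) (wave l N (th N (e N))))
                        (dilate (rho M) (wave l M (th M (e M)))))) /\
    (* infinitely many pairwise non-congruent circular waves *)
    (exists W : nat -> curve,
       (forall N : nat, circular_wave l eps0 th (W N)) /\
       (forall N M : nat, N <> M -> ~ congruent (W N) (W M))).
Proof.
  destruct branch_parameter as [r [mu [Hr [mu0 [Hmu Smu]]]]].
  set (A := rate l).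
  assert (HA : forall N, 0 < A N) by (intros N; now apply rate_pos).
  assert (HAl : forall N, A N * l = half_turns N)
    by (intros N; unfold A, rate, half_turns; field; lra).
  (* epsilon = A^3 y with |y| < r, the third derivative scaling like A^3. *)
  set (eps0 := fun N => r * A N ^ 3).
  set (m := fun N e => mu (/ A N ^ 3 * e)).
  assert (A3 : forall N, 0 < A N ^ 3) by (intros N; apply pow_lt, HA).
  assert (He : forall N e, Rabs e < eps0 N -> Rabs (/ A N ^ 3 * e) < r).
  { intros N e H; specialize (A3 N).
    rewrite Rabs_mult, Rabs_inv, (Rabs_right (A N ^ 3)) by lra.
    apply (Rmult_lt_reg_r (A N ^ 3)); [exact A3|].
    replace (/ A N ^ 3 * Rabs e * A N ^ 3) with (Rabs e) by (field; apply Rgt_not_eq, HA).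
    exact H. }
  assert (Hm : forall N e, Rabs e < eps0 N -> small (m N e))
    by (intros N e H; apply Hmu, He, H).
  assert (Hm1 : forall N e, Rabs e < eps0 N -> Rabs (m N e) * 8192 < 1)
    by (intros N e H; apply small_lt1, Hm, H).
  assert (Hpos : forall N e, 0 < Rabs e < eps0 N ->
    0 < stretch (m N e) /\ prim (fun x => cos (x + angle (m N e) x)) PI <> 0).
  { intros N e [H0 H]; apply Hmu; [now apply He|].
    specialize (A3 N); apply Rmult_integral_contrapositive_currified.
    - apply Rinv_neq_0_compat; lra.
    - intros ->; rewrite Rabs_R0 in H0; lra. }
  assert (m0 : forall N, m N 0 = 0) by (intros N; unfold m; now rewrite Rmult_0_r).
  assert (Sm : forall n N, diff_on n (fun e => Rabs e < eps0 N) (m N)).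
  { intros n N; apply (diff_on_comp n _ (fun y => Rabs y < r) mu (fun e => / A N ^ 3 * e));
      [intros y; apply He | apply Smu|].
    apply diff_on_mult; [apply diff_on_const | apply diff_on_id]. }
  assert (Scomp : forall n N f, diff_on n small f ->
            diff_on n (fun e => Rabs e < eps0 N) (fun e => f (m N e)))
    by (intros n N f Hf; apply (diff_on_comp n _ small); auto).
  set (th := fun N e => wave_angle (A N) (m N e)).
  assert (Hang : forall N e, Rabs e < eps0 N ->
            has_angle (wave l N (th N e)) (wave_angle (A N) (m N e))).
  { intros N e H; apply wave_has_angle.
    - intros s; apply extend_wave_angle; auto.
    - intros s; apply wave_angle_continuous; auto. }
  assert (g0 : forall N e, wave l N (th N e) 0 = (0, 0)).
  { intros N e; unfold wave.
    rewrite !(RInt_point 0). reflexivity. }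
  assert (Hdil : forall N e rho, 0 < rho -> Rabs e < eps0 N ->
     has_angle (dilate rho (wave l N (th N e))) (wave_angle (A N / rho) (m N e))).
  { intros N e rho Hrho H.
    apply (has_angle_ext _ (fun s => wave_angle (A N) (m N e) (s / rho))).
    - intros s; apply wave_angle_dilate; lra.
    - apply has_angle_dilate; auto. }
  (* Settled before the witnesses are given, because the last claim reuses it with multiplier 1. *)
  assert (Part4 : forall lamstar : R, 0 < lamstar ->
       forall eta : nat -> R, (forall N : nat, 0 < eta N) ->
       exists e rho : nat -> R,
         (forall N : nat,
            0 < Rabs (e N) < eps0 N /\ Rabs (e N) < eta N /\ 0 < rho N /\
            circular_wave l eps0 th (dilate (rho N) (wave l N (th N (e N)))) /\
            stationary lamstar (dilate (rho N) (wave l N (th N (e N))))) /\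
         (forall N M : nat, N <> M ->
            ~ congruent (dilate (rho N) (wave l N (th N (e N))))
                        (dilate (rho M) (wave l M (th M (e M)))))).
  { intros ls Hls eta Heta.
    destruct (strictly_decreasing_choice
      (fun N e => 0 < Rabs e < eps0 N /\ Rabs e < eta N) (fun N e => stretch (m N e)))
      as [e [He1 He2]].
    { intros N y Hy.
      destruct (Scomp 1%nat N stretch (stretch_diff_on 1)) as [f' [D _]].
      assert (P0 : 0 < eps0 N) by (apply Rmult_lt_0_compat; auto).
      assert (Cs : continuous (fun e => stretch (m N e)) 0)
        by (eapply is_derive_continuous, D; rewrite Rabs_R0; exact P0).
      (* [stretch] vanishes at [mu] = 0, so continuity provides parameters with value below any
         bound. *)
      assert (S0 : stretch (m N 0) < y) by (rewrite m0; unfold stretch, angle3; lra).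
      destruct (Cs (fun z => z < y) (open_lt y _ S0)) as [del Hdel].
      pose proof (cond_pos del). specialize (Heta N).
      set (e := Rmin del (Rmin (eps0 N) (eta N)) / 2).
      assert (E : 0 < e /\ e < del /\ e < eps0 N /\ e < eta N).
      { unfold e, Rmin; destruct (Rle_dec (eps0 N) (eta N)), (Rle_dec del _); lra. }
      assert (Ea : Rabs e = e) by (apply Rabs_right; lra).
      exists e; rewrite Ea; split; [lra|]. split.
      - apply Hpos; lra.
      - apply Hdel. change (Rabs (e - 0) < del); rewrite Rminus_0_r; lra. }
    (* Dilation by rho gives the multiplier (A / rho)^4 [stretch]. With rho = A w this is [stretch]
       / w^4, so w has to be the fourth root of [stretch / ls]; the dilated rate is then 1 / w. *)
    set (w := fun N => sqrt (sqrt (stretch (m N (e N)) / ls))).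
    assert (Hw : forall N, 0 < w N /\ w N ^ 4 = stretch (m N (e N)) / ls).
    { intros N; destruct (Hpos N (e N)) as [P _]; [apply He1|].
      assert (Q : 0 < stretch (m N (e N)) / ls) by (now apply Rdiv_lt_0_compat).
      split; [now apply sqrt_lt_R0, sqrt_lt_R0|].
      replace (w N ^ 4) with ((w N ^ 2) ^ 2) by ring.
      unfold w; rewrite !pow2_sqrt; [reflexivity | lra | apply sqrt_pos]. }
    assert (Hrho : forall N, 0 < A N * w N)
      by (intros N; apply Rmult_lt_0_compat; [apply HA | apply Hw]).
    assert (Hq : forall N, A N / (A N * w N) = / w N).
    { intros N; specialize (HA N); destruct (Hw N); field; lra. }
    exists e, (fun N => A N * w N); split.
    - intros N; destruct (He1 N) as [E1 E2]; split; [exact E1|].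
      split; [exact E2|]; split; [apply Hrho|]; split.
      + exists N, (e N), (A N * w N); auto.
      + destruct (Hw N) as [W1 W2].
        replace ls with ((A N / (A N * w N)) ^ 4 * stretch (m N (e N))).
        * exact (stationary_angle _ _ (Hdil N (e N) _ (Hrho N) (proj2 E1)) _ _ _ _ _
                   (wave_elastic _ _ (Hm1 N (e N) (proj2 E1)))).
        * rewrite Hq, pow_inv, W2. destruct (Hpos N (e N) E1). field; lra.
    - intros N M HNM C.
      assert (E : A N / (A N * w N) = A M / (A M * w M)).
      { eapply wave_congruent_rate; [| | | | apply Hdil | apply Hdil | exact C];
          try apply Hm; try apply He1; try apply Hrho;
          apply Rdiv_lt_0_compat; auto. }
      rewrite !Hq in E; apply Rinv_eq_reg in E.
      destruct (Hw N) as [_ WN]; destruct (Hw M) as [_ WM]. rewrite E, WM in WN.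
      assert (F : stretch (m M (e M)) = stretch (m N (e N))).
      { apply (Rmult_eq_reg_r (/ ls)); [exact WN | apply Rinv_neq_0_compat; lra]. }
      destruct (Nat.lt_gt_cases N M) as [H _]; destruct (H HNM) as [L|L];
        apply He2 in L; lra. }
  exists eps0, (fun N e => A N * (1 + angle1 (m N e) 0)), (fun N e => A N ^ 3 * angle3 (m N e) 0),
    (fun N e => A N ^ 4 * stretch (m N e)),
    (fun N e s => A N * (1 + angle1 (m N e) (A N * s))),
    (fun N e s => A N ^ 2 * angle2 (m N e) (A N * s)),
    (fun N e s => A N ^ 3 * angle3 (m N e) (A N * s)), th.
  assert (Sscal : forall N c f, (forall n, diff_on n small f) ->
            smooth_on (fun e => Rabs e < eps0 N) (fun e => c * f (m N e))).
  { intros N c f Hf n x Hx; apply (diff_on_ex_derive_n (fun e => Rabs e < eps0 N)).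
    - apply open_Rabs_lt.
    - apply diff_on_mult; [apply diff_on_const | apply Scomp, Hf].
    - exact Hx. }
  split; [|split; [|split; [|split; [|split; [|split; [exact Part4|]]]]]].
  - intros N; split; [apply Rmult_lt_0_compat; auto|].
    split; [|split; [|split; [|split; [|split; [|split]]]]].
    + apply (Sscal N (A N) (fun mu => 1 + angle1 mu 0)).
      intros n; apply diff_on_plus; [apply diff_on_const | apply angle1_diff_on].
    + apply (Sscal N (A N ^ 3) (fun mu => angle3 mu 0)); intros n; apply angle3_diff_on.
    + apply (Sscal N (A N ^ 4) stretch), stretch_diff_on.
    + rewrite m0; unfold angle1. change ((2 * INR N + 1) * PI / l) with (A N). ring.
    + rewrite m0; unfold angle3; ring.
    + rewrite m0; unfold stretch, angle3; ring.
    + intros e H.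
      destruct (wave_elastic (A N) (m N e) (Hm1 N e H)) as [H1 H2 H3 H4 _].
      pose proof (Hm1 N e H) as Hs.
      (* A l is PI plus N periods, hence a zero of every odd periodic function; this gives the
         conditions on [th] and [p] at l. *)
      assert (odd : forall f, odd_periodic f -> f (A N * l) = 0).
      { intros f [Hc [Ho Hp]]; rewrite HAl.
        replace (half_turns N) with (PI + INR N * (2 * PI)) by (unfold half_turns; ring).
        rewrite (shift_iter f (2 * PI) 0), (odd_periodic_at_PI f); [ring | now split|].
        intros y; rewrite Hp; ring. }
      assert (sol : arc_solution l (A N * (1 + angle1 (m N e) 0)) (A N ^ 3 * angle3 (m N e) 0)
        (A N ^ 4 * stretch (m N e)) (fun s => A N * (1 + angle1 (m N e) (A N * s)))
        (fun s => A N ^ 2 * angle2 (m N e) (A N * s))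
        (fun s => A N ^ 3 * angle3 (m N e) (A N * s)) (th N e)).
      { assert (c : A N * (1 + angle1 (m N e) 0) * (A N ^ 3 * angle3 (m N e) 0)
                    + A N ^ 4 * stretch (m N e) = A N ^ 4 * m N e)
          by (unfold stretch; ring).
        split; try (intros s Hsl; apply is_derive_is_derive_within; [exact Hsl|]; auto).
        - rewrite c; apply H4.
        - now rewrite Rmult_0_r.
        - rewrite Rmult_0_r, (odd_periodic_at_0 (angle2 (m N e))); [ring|].
          now apply angle2_odd_periodic.
        - now rewrite Rmult_0_r.
        - unfold th, wave_angle; rewrite Rmult_0_r, (odd_periodic_at_0 (angle (m N e))); [ring|].
          now apply angle_odd_periodic. }
      split; [split; [exact sol|]|split; [|split]].
      * intros k' p' q' th' sol'.
        now apply arc_solution_unique with (2 := sol) (3 := sol').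
      * unfold th, wave_angle; rewrite (odd (angle (m N e))) by now apply angle_odd_periodic.
        rewrite HAl; unfold half_turns; ring.
      * rewrite (odd (angle2 (m N e))) by now apply angle2_odd_periodic. ring.
      (* [angle3] does not vanish here; periodicity moves the argument to PI, where the choice of
         the parameter prescribes its value. *)
      * assert (E3 : angle3 (m N e) (A N * l) = angle3 (m N e) PI).
        { rewrite HAl.
          replace (half_turns N) with (PI + INR N * (2 * PI)) by (unfold half_turns; ring).
          rewrite (shift_iter (angle3 (m N e)) (2 * PI) 0); [ring|].
          intros y; unfold angle3.
          destruct (prim0_even_periodic _ (sin_sum_odd_periodic (m N e) Hs)) as [_ [_ Hp]].
          rewrite Hp; ring. }
        rewrite E3; destruct (Hmu _ (He N e H)) as [_ [E4 _]].
        unfold m; rewrite E4; field. apply Rgt_not_eq, HA.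
  (* The parameter range was already reduced to the neighbourhood where [stretch] is positive, so
     the whole branch qualifies. *)
  - intros N; exists (eps0 N); split; [split; [apply Rmult_lt_0_compat; auto | lra]|].
    intros e H; apply Rmult_lt_0_compat; [apply pow_lt, HA | apply Hpos, H].
  - intros N e H; destruct (Hpos N e H) as [_ Hk]; destruct H as [_ H].
    pose proof (Hang N e H) as Hg; pose proof (Hm1 N e H) as Hs.
    pose proof (wave_elastic (A N) (m N e) Hs) as HE.
    split; [|split; [|split; [|split]]].
    + exact (unit_speed_immersion_angle _ _ Hg _ _ _ _ _ HE).
    + exact (stationary_angle _ _ Hg _ _ _ _ _ HE).
    + exact (velocity_shift (A N) (m N e) Hs l N (HAl N) _ Hg).
    + exists (wave l N (th N e) (2 * l)); split.
      * intros E; apply (cy_period_neq_0 (A N) (m N e) (HA N) Hs l N (HAl N) _ Hg (g0 N e) Hk).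
        unfold cy; now rewrite E.
      * intros s; apply injective_projections.
        -- exact (cx_shift (A N) (m N e) Hs l N (HAl N) _ Hg (g0 N e) s).
        -- exact (cy_shift (A N) (m N e) Hs l N (HAl N) _ Hg (g0 N e) s).
    + exact (wave_not_closed (A N) (m N e) (HA N) Hs l N hl (HAl N) _ Hg (g0 N e) Hk).
  - intros N M e e' HNM [_ H] [_ H'] C; apply HNM, (rate_inj l N M hl).
    exact (wave_congruent_rate (A N) (A M) (m N e) (m M e') _ _ (HA N) (HA M) (Hm N e H)
             (Hm M e' H') (Hang N e H) (Hang M e' H') C).
  - intros N e [_ H].
    exact (wave_turning_rate (A N) (m N e) (HA N) (Hm1 N e H) l N hl (HAl N) _ (Hang N e H)).
  - destruct (Part4 1 Rlt_0_1 (fun _ => 1)) as [e [rho [W1 W2]]]; [intros; exact Rlt_0_1|].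
    exists (fun N => dilate (rho N) (wave l N (th N (e N)))); split; [|exact W2].
    intros N; apply W1.
Qed.
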